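(* Let $\mathcal{C}$ be a small extriangulated category with enough $\mathbb{E}$-projectives, $n\geq0$, and $\mathcal{X}=\mathrm{add}(\mathcal{X})$ an $(n+2)$-rigid subcategory of $\mathcal{C}$ with $\mathcal{P}_{\mathbb{E}}(\mathcal{C})\subseteq\mathcal{X}$. Let $(\mathcal{M}_1,\varepsilon_1):=(\mathcal{X}_{n+1}^{\vee}/[\mathcal{X}],\varepsilon_{\mathbb{F}})$, which is a weakly idempotent complete exact category, and let $(\varepsilon_1(\mathcal{M}_1),\varepsilon_1)$ be its category of conflations. Then: (a) $\mathcal{S}(\mathcal{M}_1)$ is a pseudo-cluster tilting subcategory in $(\varepsilon_1(\mathcal{M}_1),\varepsilon_1)$. In particular, $\varepsilon_1(\mathcal{M}_1)=\mathcal{S}(\mathcal{M}_1)_1^{\wedge}=\mathcal{S}(\mathcal{M}_1)_1^{\vee}$. (b) The quotient $\varepsilon_1(\mathcal{M}_1)/[\mathcal{S}(\mathcal{M}_1)]$ is an abelian category. (c) $\mathcal{S}(\mathcal{M}_1)$ can be described in terms of the exact equivalence $\mathbb{F}:\mathcal{M}_1\to\mathcal{R}_{\mathcal{X}}^n$ as follows: for a conflation $\eta:K\overset{[a]}{\rightarrowtail}M\overset{[b]}{\twoheadrightarrow}N$ in $\mathcal{M}_1$, we have $\eta\in\mathcal{S}(\mathcal{M}_1)$ if and only if there exist a split $\mathbb{E}$-triangle $K'\xrightarrow{a'}M\oplus X\oplus P\xrightarrow{(b\ g\ p)}N\overset{\delta}{\dashrightarrow}$ in $\mathcal{C}$ with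 $X\in\mathcal{X}$ and $P\in\mathcal{P}_{\mathbb{E}}(\mathcal{C})$, and an isomorphism $\mathbb{F}(K')\to\mathbb{F}(K)$ in $\mathcal{R}_{\mathcal{X}}^n$ which, together with the identities of $\mathbb{F}(M)$ and $\mathbb{F}(N)$, gives a commutative diagram in $\mathcal{R}_{\mathcal{X}}^n$ from the conflation $\mathbb{F}(K')\overset{\mathbb{F}[a']}{\rightarrowtail}\mathbb{F}(M)\overset{\mathbb{F}[b]}{\twoheadrightarrow}\mathbb{F}(N)$ to the conflation $\mathbb{F}(K)\overset{\mathbb{F}[a]}{\rightarrowtail}\mathbb{F}(M)\overset{\mathbb{F}[b]}{\twoheadrightarrow}\mathbb{F}(N)$ (here $\mathbb{F}(M\oplus X\oplus P)$ is identified with $\mathbb{F}(M)$, since $X$ and $P$ are zero in $\mathcal{M}_1$).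
   Context: All classes of objects are regarded as full subcategories. An extriangulated category $(\mathcal{C},\mathbb{E},\mathfrak{s})$ (in the sense of Nakaoka–Palu) is an additive category $\mathcal{C}$ with an additive bifunctor $\mathbb{E}:\mathcal{C}^{op}\times\mathcal{C}\to Ab$ and an additive realization $\mathfrak{s}$, assigning to each $\delta\in\mathbb{E}(C,A)$ an equivalence class of sequences $A\to B\to C$, satisfying (ET3), (ET3)$^{op}$, (ET4), (ET4)$^{op}$. A sequence $A\xrightarrow{x}B\xrightarrow{y}C$ realizing some $\delta\in\mathbb{E}(C,A)$ is a conflation ($x$ is an inflation, $y$ a deflation), and together with $\delta$ it is an $\mathbb{E}$-triangle $A\to B\to C\overset{\delta}{\dashrightarrow}$, split if $\delta=0$. A morphism $f$ is $\mathbb{E}$-projective if $\mathbb{E}(f,-)=0$ (class $\mathcal{P}_{1,\mathbb{E}}(\mathcal{C})$) and $\mathbb{E}$-injective if $\mathbb{E}(-,f)=0$ (class $\mathcal{I}_{1,\mathbb{E}}(\mathcal{C})$). An object $P$ is $\mathbb{E}$-projective (class $\mathcal{P}_{\mathbb{E}}(\mathcal{C})$) if $\mathcal{C}(P,y)$ is surjective for every deflation $y$. $\mathcal{C}$ has enough $\mathbb{E}$-projectives if every object $C$ admits a deflation $P\to C$ with $P\in\mathcal{P}_{\mathbb{E}}(\mathcal{C})$. Higher $\mathbb{E}$-extension groups: a family $\{\mathbb{E}^i\}_{i\geq1}$ of additive bifunctors $\mathcal{C}^{op}\times\mathcal{C}\to Ab$ with $\mathbb{E}^1=\mathbb{E}$;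 for each $\mathbb{E}$-triangle $A\to B\to C\dashrightarrow$ and each $i\geq 1$ there are natural transformations $\mathbb{E}^i(A,-)\to\mathbb{E}^{i+1}(C,-)$ and $\mathbb{E}^i(-,C)\to\mathbb{E}^{i+1}(-,A)$, compatible with morphisms of $\mathbb{E}$-triangles, making $\mathbb{E}^i(C,-)\to\mathbb{E}^i(B,-)\to\mathbb{E}^i(A,-)\to\mathbb{E}^{i+1}(C,-)$ and $\mathbb{E}^i(-,A)\to\mathbb{E}^i(-,B)\to\mathbb{E}^i(-,C)\to\mathbb{E}^{i+1}(-,A)$ exact; and $\mathbb{E}^i(f,-)=0$, $\mathbb{E}^i(-,g)=0$ for all $i\geq1$, $f\in\mathcal{P}_{1,\mathbb{E}}(\mathcal{C})$, $g\in\mathcal{I}_{1,\mathbb{E}}(\mathcal{C})$. Every small extriangulated category has such a family; one is fixed. $\mathcal{X}\subseteq\mathcal{C}$ is $(n+2)$-rigid if $\mathbb{E}^i(X,X')=0$ for all $X,X'\in\mathcal{X}$ and $1\leq i\leq n+1$. $\mathrm{add}(\mathcal{X})$ is the class of direct summands of finite coproducts of objects of $\mathcal{X}$. A finite $\mathcal{X}$-coresolution of $C$ of length $m\geq 0$ consists of objects $C=K_0,\dots,K_m$ and $X_0,\dots,X_m\in\mathcal{X}$, conflations $K_i\to X_i\to K_{i+1}$ for $0\leq i<m$, and an isomorphism $K_m\simeq X_m$; finite resolutions are dual (conflations $K_{i+1}\to X_i\to K_i$). $\mathcal{X}_n^{\vee}$ (resp. $\mathcal{X}_n^{\wedge}$)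 is the class of objects with a finite $\mathcal{X}$-coresolution (resp. resolution) of length $\leq n$. The same notation is used in exact categories. $[\mathcal{X}]$ is the ideal of morphisms factoring through objects of $\mathcal{X}$; $[h]$ is the class of $h$ in the quotient. $\underline{\mathcal{X}_n^{\vee}}$ is the quotient of $\mathcal{X}_n^{\vee}$ by the ideal of its morphisms $f$ with $\mathbb{E}(f,-)=0$; $\mathsf{Mod}\,\underline{\mathcal{X}_n^{\vee}}$ is the category of contravariant additive functors $\underline{\mathcal{X}_n^{\vee}}\to Ab$. $\underline{\mathbb{E}}(-,M)$ is the functor on $\underline{\mathcal{X}_n^{\vee}}$ induced by $\mathbb{E}(-,M)|_{\mathcal{X}_n^{\vee}}$, and $\mathbb{F}:\mathcal{X}_{n+1}^{\vee}/[\mathcal{X}]\to\mathsf{Mod}\,\underline{\mathcal{X}_n^{\vee}}$, $M\mapsto\underline{\mathbb{E}}(-,M)$, is the induced (fully faithful) functor. $\mathcal{R}_{\mathcal{X}}^n\subseteq\mathsf{Mod}\,\underline{\mathcal{X}_n^{\vee}}$ is the full subcategory of those $G$ with an exact sequence $\underline{\mathcal{X}_n^{\vee}}(-,X_0)\to\underline{\mathcal{X}_n^{\vee}}(-,X_1)\to G\to0$, $X_0\in\mathcal{X}$, $X_1\in\mathcal{X}_n^{\vee}$; it is extension-closed and viewed as an exact category with the induced structure. $\varepsilon_{\mathbb{F}}$ is the class of pairs $A'\to A\to A''$ in $\mathcal{X}_{n+1}^{\vee}/[\mathcal{X}]$ with $0\to\mathbb{F}(A')\to\mathbb{F}(A)\to\mathbb{F}(A'')\to0$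 exact in $\mathsf{Mod}\,\underline{\mathcal{X}_n^{\vee}}$. $\mathbb{F}:(\mathcal{X}_{n+1}^{\vee}/[\mathcal{X}],\varepsilon_{\mathbb{F}})\to\mathcal{R}_{\mathcal{X}}^n$ is an equivalence of exact categories. An additive category is weakly idempotent complete if every split epimorphism has a kernel. For an exact category $(\mathcal{M},\varepsilon)$, the category of conflations $\varepsilon(\mathcal{M})$ has as objects the conflations $X_1\rightarrowtail X_2\twoheadrightarrow X_3$ of $\mathcal{M}$ and as morphisms the commutative diagrams (triples of morphisms) between them; it has an exact structure computed degree-wise, denoted $(\varepsilon(\mathcal{M}),\varepsilon)$. $\mathcal{S}(\mathcal{M})$ is the class of all split conflations in $\mathcal{M}$. A class $\mathcal{D}\subseteq\mathcal{M}$ is pseudo-cluster tilting in $(\mathcal{M},\varepsilon)$ if $\mathcal{D}=\mathrm{add}(\mathcal{D})$ and for each $M\in\mathcal{M}$ there are conflations $M\xrightarrow{\alpha}D_0\to D_1$ and $D_1'\to D_0'\xrightarrow{\beta}M$ with $D_0,D_1,D_0',D_1'\in\mathcal{D}$, where $\alpha$ is a $\mathcal{D}$-preenvelope (every morphism from $M$ to an object of $\mathcal{D}$ factors through $\alpha$) and $\beta$ is a $\mathcal{D}$-precover (every morphism from an object of $\mathcal{D}$ to $M$ factors through $\beta$). *)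

(* Defs.v *)
From HB Require Import structures.
From mathcomp Require Import all_boot ssralg generic_quotient ring_quotient.
From mathcomp Require Import boolp.

Set Implicit Arguments.
Unset Strict Implicit.
Unset Printing Implicit Defensive.

Import GRing.Theory.
Local Open Scope ring_scope.
Local Open Scope quotient_scope.

Record precat := Precat {
  ob :> Type;
  hom : ob -> ob -> zmodType;
  idm : forall A, hom A A;
  comp : forall A B D, hom B D -> hom A B -> hom A D;
  comp1m : forall A B (f : hom A B), comp (idm B) f = f;
  compm1 : forall A B (f : hom A B), comp f (idm A) = f;
  compA : forall A B D E (h : hom D E) (g : hom B D) (f : hom A B),
    comp h (comp g f) = comp (comp h g) f;
  compDl : forall A B D (g g' : hom B D) (f : hom A B),
    comp (g + g') f = comp g f + comp g' f;
  compDr : forall A B D (g : hom B D) (f f' : hom A B),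
    comp g (f + f') = comp g f + comp g f' }.

Arguments hom {p} _ _.
Arguments idm {p} _.
Arguments comp {p A B D} _ _.

Notation "g \oc f" := (comp g f)
  (at level 40, left associativity, format "g  \oc  f") : ring_scope.

Section PrecatTheory.
Variable C : precat.

Lemma comp0m (A B D : C) (f : hom A B) : (0 : hom B D) \oc f = 0.
Proof. by apply: (@addrI _ (0 \oc f)); rewrite -compDl !addr0. Qed.

Lemma compm0 (A B D : C) (g : hom B D) : g \oc (0 : hom A B) = 0.
Proof. by apply: (@addrI _ (g \oc 0)); rewrite -compDr !addr0. Qed.

Lemma compNm (A B D : C) (g : hom B D) (f : hom A B) : (- g) \oc f = - (g \oc f).
Proof.
by apply: (@addrI _ (g \oc f)); rewrite -compDl !subrr comp0m.
Qed.

Lemma compmN (A B D : C) (g : hom B D) (f : hom A B) : g \oc (- f) = - (g \oc f).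
Proof.
by apply: (@addrI _ (g \oc f)); rewrite -compDr !subrr compm0.
Qed.

Lemma comp_suml (I : Type) (r : seq I) (P : pred I) (A B D : C)
    (G : I -> hom B D) (f : hom A B) :
  (\sum_(i <- r | P i) G i) \oc f = \sum_(i <- r | P i) (G i \oc f).
Proof.
by apply: (big_morph (fun g : hom B D => g \oc f)) => [g h|];
  rewrite ?compDl ?comp0m.
Qed.

Lemma comp_sumr (I : Type) (r : seq I) (P : pred I) (A B D : C)
    (g : hom B D) (F : I -> hom A B) :
  g \oc (\sum_(i <- r | P i) F i) = \sum_(i <- r | P i) (g \oc F i).
Proof.
by apply: (big_morph (fun f : hom A B => g \oc f)) => [f h|];
  rewrite ?compDr ?compm0.
Qed.

End PrecatTheory.

Section Notions.
Variable C : precat.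

Definition is_iso (A B : C) (f : hom A B) :=
  exists g : hom B A, g \oc f = idm A /\ f \oc g = idm B.

Definition isomorphic (A B : C) := exists f : hom A B, is_iso f.

Definition mono (A B : C) (f : hom A B) :=
  forall T (u v : hom T A), f \oc u = f \oc v -> u = v.

Definition epi (A B : C) (f : hom A B) :=
  forall T (u v : hom B T), u \oc f = v \oc f -> u = v.

Definition split_epi (A B : C) (f : hom A B) :=
  exists s : hom B A, f \oc s = idm B.

Definition is_zero (Z : C) :=
  forall A : C, (forall f g : hom A Z, f = g) /\ (forall f g : hom Z A, f = g).

Definition is_biproduct (A B S : C) (i1 : hom A S) (i2 : hom B S)
    (p1 : hom S A) (p2 : hom S B) :=
  [/\ p1 \oc i1 = idm A, p2 \oc i2 = idm B, p1 \oc i2 = 0, p2 \oc i1 = 0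
    & i1 \oc p1 + i2 \oc p2 = idm S].

Record biproduct (A B : C) := Biproduct {
  bp_ob :> C;
  inl : hom A bp_ob;
  inr : hom B bp_ob;
  prl : hom bp_ob A;
  prr : hom bp_ob B;
  bpP : is_biproduct inl inr prl prr }.

Definition copair (A B T : C) (S : biproduct A B) (f : hom A T) (g : hom B T)
  : hom S T := f \oc prl S + g \oc prr S.

Definition dsum (A B A' B' : C) (S : biproduct A B) (S' : biproduct A' B')
    (f : hom A A') (g : hom B B') : hom S S' :=
  inl S' \oc f \oc prl S + inr S' \oc g \oc prr S.

Definition is_additive :=
  (exists Z, is_zero Z) /\ forall A B : C, inhabited (biproduct A B).

Definition is_coproduct (k : nat) (A : 'I_k -> C) (S : C)
    (inj : forall i, hom (A i) S) :=
  forall (T : C) (f : forall i, hom (A i) T),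
    exists! u : hom S T, forall i, u \oc inj i = f i.

Definition add (X : C -> Prop) (A : C) :=
  exists (A' : C) (S : biproduct A A') (k : nat) (Y : 'I_k -> C) (U : C)
         (inj : forall i, hom (Y i) U),
    [/\ forall i, X (Y i), is_coproduct inj & isomorphic S U].

Definition is_kernel (A B K : C) (f : hom A B) (k : hom K A) :=
  f \oc k = 0 /\
  forall T (t : hom T A), f \oc t = 0 -> exists! u : hom T K, k \oc u = t.

Definition is_cokernel (A B Q : C) (f : hom A B) (q : hom B Q) :=
  q \oc f = 0 /\
  forall T (t : hom B T), t \oc f = 0 -> exists! u : hom Q T, u \oc q = t.

Definition is_pushout (A B A' B' : C) (i : hom A B) (f : hom A A')
    (i' : hom A' B') (f' : hom B B') :=
  f' \oc i = i' \oc f /\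
  forall T (u : hom B T) (v : hom A' T), u \oc i = v \oc f ->
    exists! w : hom B' T, w \oc f' = u /\ w \oc i' = v.

Definition is_pullback (B D B' D' : C) (p : hom B D) (f : hom D' D)
    (p' : hom B' D') (f' : hom B' B) :=
  p \oc f' = f \oc p' /\
  forall T (u : hom T B) (v : hom T D'), p \oc u = f \oc v ->
    exists! w : hom T B', f' \oc w = u /\ p' \oc w = v.

Definition weakly_idempotent_complete :=
  forall (A B : C) (f : hom A B), split_epi f ->
    exists (K : C) (k : hom K A), is_kernel f k.

Definition is_abelian :=
  [/\ is_additive,
      forall (A B : C) (f : hom A B), exists (K : C) (k : hom K A), is_kernel f k,
      forall (A B : C) (f : hom A B), exists (Q : C) (q : hom B Q), is_cokernel f q,
      forall (A B : C) (f : hom A B), mono f ->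
        exists (D : C) (g : hom B D), is_kernel g f
    & forall (A B : C) (f : hom A B), epi f ->
        exists (D : C) (g : hom D A), is_cokernel g f].

End Notions.

Definition conf_class (C : precat) :=
  forall A B D : C, hom A B -> hom B D -> Prop.

Section Conflations.
Variables (C : precat) (conf : conf_class C).

Definition inflation (A B : C) (x : hom A B) :=
  exists (D : C) (y : hom B D), conf x y.

Definition deflation (B D : C) (y : hom B D) :=
  exists (A : C) (x : hom A B), conf x y.

(** Quillen's axioms, in Buehler's form. *)
Record is_exact : Prop := IsExact {
  exact_additive : is_additive C;
  exact_kercoker : forall (A B D : C) (x : hom A B) (y : hom B D),
    conf x y -> is_kernel y x /\ is_cokernel x y;
  exact_isoclosed : forall (A B D A' B' D' : C) (x : hom A B) (y : hom B D)
      (x' : hom A' B') (y' : hom B' D') (a : hom A A') (b : hom B B') (d : hom D D'),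
    conf x y -> is_iso a -> is_iso b -> is_iso d ->
    b \oc x = x' \oc a -> d \oc y = y' \oc b -> conf x' y';
  exact_inf_id : forall A : C, inflation (idm A);
  exact_def_id : forall A : C, deflation (idm A);
  exact_inf_comp : forall (A B D : C) (x : hom A B) (x' : hom B D),
    inflation x -> inflation x' -> inflation (x' \oc x);
  exact_def_comp : forall (A B D : C) (y : hom A B) (y' : hom B D),
    deflation y -> deflation y' -> deflation (y' \oc y);
  exact_pushout : forall (A B A' : C) (i : hom A B) (f : hom A A'),
    inflation i -> exists (B' : C) (i' : hom A' B') (f' : hom B B'),
      is_pushout i f i' f' /\ inflation i';
  exact_pullback : forall (B D D' : C) (p : hom B D) (f : hom D' D),
    deflation p -> exists (B' : C) (p' : hom B' D') (f' : hom B' B),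
      is_pullback p f p' f' /\ deflation p' }.

Inductive coresolution (X : C -> Prop) : nat -> C -> Prop :=
| Coresolution0 K Y : X Y -> isomorphic K Y -> coresolution X 0 K
| CoresolutionS m K Y K' (x : hom K Y) (y : hom Y K') :
    X Y -> conf x y -> coresolution X m K' -> coresolution X m.+1 K.

Inductive resolution (X : C -> Prop) : nat -> C -> Prop :=
| Resolution0 K Y : X Y -> isomorphic K Y -> resolution X 0 K
| ResolutionS m K Y K' (x : hom K' Y) (y : hom Y K) :
    X Y -> conf x y -> resolution X m K' -> resolution X m.+1 K.

Definition vee (X : C -> Prop) (n : nat) (K : C) :=
  exists2 m, (m <= n)%N & coresolution X m K.

Definition wedge (X : C -> Prop) (n : nat) (K : C) :=
  exists2 m, (m <= n)%N & resolution X m K.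

Definition preenvelope (D : C -> Prop) (M D0 : C) (a : hom M D0) :=
  D D0 /\ forall D1 (f : hom M D1), D D1 -> exists g : hom D0 D1, f = g \oc a.

Definition precover (D : C -> Prop) (M D0 : C) (b : hom D0 M) :=
  D D0 /\ forall D1 (f : hom D1 M), D D1 -> exists g : hom D1 D0, f = b \oc g.

Definition pseudo_cluster_tilting (D : C -> Prop) :=
  (forall M, D M <-> add D M) /\
  forall M : C,
    (exists (D0 D1 : C) (a : hom M D0) (b : hom D0 D1),
       [/\ D D0, D D1, conf a b & preenvelope D a]) /\
    (exists (D0 D1 : C) (a : hom D1 D0) (b : hom D0 M),
       [/\ D D0, D D1, conf a b & precover D b]).

End Conflations.

Definition full_sub (C : precat) (P : C -> Prop) : precat :=
  @Precat {A : C | P A} (fun A B => hom (sval A) (sval B))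
    (fun A => idm (sval A)) (fun A B D g f => g \oc f)
    (fun A B f => comp1m f) (fun A B f => compm1 f)
    (fun A B D E h g f => compA h g f)
    (fun A B D g g' f => compDl g g' f) (fun A B D g f f' => compDr g f f').

Record ideal (C : precat) := Ideal {
  imem : forall A B : C, hom A B -> Prop;
  imem0 : forall A B : C, imem (0 : hom A B);
  imemB : forall (A B : C) (f g : hom A B), imem f -> imem g -> imem (f - g);
  imem_post : forall (A B D : C) (g : hom B D) (f : hom A B), imem f -> imem (g \oc f);
  imem_pre : forall (A B D : C) (g : hom B D) (f : hom A B), imem g -> imem (g \oc f) }.

Definition ideal_pred (C : precat) (I : ideal C) (A B : C) : pred (hom A B) :=
  fun f => `[< imem I f >].

Lemma ideal_pred_zmod (C : precat) (I : ideal C) (A B : C) :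
  zmod_closed (@ideal_pred C I A B).
Proof.
split=> [|f g]; rewrite !unfold_in /=; first by apply/asboolP/imem0.
by move=> /asboolP If /asboolP Ig; apply/asboolP/imemB.
Qed.

HB.instance Definition _ (C : precat) (I : ideal C) (A B : C) :=
  GRing.isZmodClosed.Build (hom A B) (@ideal_pred C I A B)
    (@ideal_pred_zmod C I A B).

Section Quotient.
Variables (C : precat) (I : ideal C).

Definition qhom (A B : C) : zmodType :=
  @Quotient.quot (hom A B) (GRing.ZmodClosed.clone (hom A B) (@ideal_pred C I A B) _).

Definition cls (A B : C) (f : hom A B) : qhom A B := \pi f.

Lemma cls_eqP (A B : C) (f g : hom A B) : cls f = cls g <-> imem I (f - g).
Proof.
split=> [/eqP|H].
  by rewrite -[_ == _]Quotient.idealrBE unfold_in => /asboolP.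
by apply/eqP; rewrite -[_ == _]Quotient.idealrBE unfold_in; apply/asboolP.
Qed.

Lemma clsD (A B : C) (f g : hom A B) : cls (f + g) = cls f + cls g.
Proof. by rewrite /cls raddfD. Qed.

Lemma cls_repr (A B : C) (q : qhom A B) : cls (repr q) = q.
Proof. exact: reprK. Qed.

Lemma imem_repr (A B : C) (f : hom A B) : imem I (repr (cls f) - f).
Proof. by apply/cls_eqP; rewrite cls_repr. Qed.

Definition qcomp (A B D : C) (g : qhom B D) (f : qhom A B) : qhom A D :=
  cls (repr g \oc repr f).

Lemma qcomp_cls (A B D : C) (g : hom B D) (f : hom A B) :
  qcomp (cls g) (cls f) = cls (g \oc f).
Proof.
apply/cls_eqP.
set g' := repr _; set f' := repr _.
have -> : g' \oc f' - g \oc f = (g' - g) \oc f' - (- (g \oc (f' - f))).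
  by rewrite compDl compDr compNm compmN opprK addrA addrNK.
apply: imemB; first by apply: imem_pre; apply: imem_repr.
rewrite -compmN opprB -opprB; apply: imem_post.
by rewrite -sub0r; apply: imemB; [apply: imem0 | apply: imem_repr].
Qed.

Lemma qcomp1m A B (f : qhom A B) : qcomp (cls (idm B)) f = f.
Proof. by rewrite -[f]cls_repr qcomp_cls comp1m. Qed.

Lemma qcompm1 A B (f : qhom A B) : qcomp f (cls (idm A)) = f.
Proof. by rewrite -[f]cls_repr qcomp_cls compm1. Qed.

Lemma qcompA A B D E (h : qhom D E) (g : qhom B D) (f : qhom A B) :
  qcomp h (qcomp g f) = qcomp (qcomp h g) f.
Proof.
by rewrite -[f]cls_repr -[g]cls_repr -[h]cls_repr !qcomp_cls compA.
Qed.

Lemma qcompDl A B D (g g' : qhom B D) (f : qhom A B) :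
  qcomp (g + g') f = qcomp g f + qcomp g' f.
Proof.
by rewrite -[f]cls_repr -[g]cls_repr -[g']cls_repr -clsD !qcomp_cls compDl clsD.
Qed.

Lemma qcompDr A B D (g : qhom B D) (f f' : qhom A B) :
  qcomp g (f + f') = qcomp g f + qcomp g f'.
Proof.
by rewrite -[f]cls_repr -[g]cls_repr -[f']cls_repr -clsD !qcomp_cls compDr clsD.
Qed.

Definition quot_cat : precat :=
  @Precat C qhom (fun A => cls (idm A)) qcomp
    qcomp1m qcompm1 qcompA qcompDl qcompDr.

End Quotient.

Arguments cls {C} I {A B} f.

Section FactorIdeal.
Variables (C : precat) (X : C -> Prop).

Definition factors (A B : C) (f : hom A B) :=
  exists (Y : C) (u : hom A Y) (v : hom Y B), X Y /\ f = v \oc u.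

(** The ideal generated by the morphisms factoring through [X]; when [X] is
    closed under finite sums these are already all its elements, see
    [factor_idealP]. *)
Definition sum_factors (A B : C) (f : hom A B) :=
  exists s : seq (hom A B), (forall g, g \in s -> factors g) /\ f = \sum_(g <- s) g.

Lemma sum_factors0 (A B : C) : sum_factors (0 : hom A B).
Proof. by exists [::]; rewrite big_nil. Qed.

Lemma factorsN (A B : C) (f : hom A B) : factors f -> factors (- f).
Proof. by move=> [Y [u [v [XY ->]]]]; exists Y, u, (- v); rewrite compNm. Qed.

Lemma sum_factorsB (A B : C) (f g : hom A B) :
  sum_factors f -> sum_factors g -> sum_factors (f - g).
Proof.
move=> [s [sX ->]] [t [tX ->]]; exists (s ++ [seq - h | h <- t]); split.
  move=> h; rewrite mem_cat => /orP[/sX //|/mapP[k /tX kX ->]].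
  exact: factorsN.
by rewrite big_cat big_map sumrN.
Qed.

Lemma sum_factors_post (A B D : C) (g : hom B D) (f : hom A B) :
  sum_factors f -> sum_factors (g \oc f).
Proof.
move=> [s [sX ->]]; exists [seq g \oc h | h <- s]; split.
  move=> h /mapP[k /sX [Y [u [v [XY ->]]]] ->].
  by exists Y, u, (g \oc v); rewrite compA.
by rewrite big_map comp_sumr.
Qed.

Lemma sum_factors_pre (A B D : C) (g : hom B D) (f : hom A B) :
  sum_factors g -> sum_factors (g \oc f).
Proof.
move=> [s [sX ->]]; exists [seq h \oc f | h <- s]; split.
  move=> h /mapP[k /sX [Y [u [v [XY ->]]]] ->].
  by exists Y, (u \oc f), v; rewrite compA.
by rewrite big_map comp_suml.
Qed.

Definition factor_ideal : ideal C :=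
  Ideal sum_factors0 sum_factorsB sum_factors_post sum_factors_pre.

Lemma factor_idealP :
  (exists2 Z, X Z & is_zero Z) ->
  (forall Y Y', X Y -> X Y' -> exists S : biproduct Y Y', X S) ->
  forall (A B : C) (f : hom A B), imem factor_ideal f <-> factors f.
Proof.
move=> [Z XZ Z0] XD A B f; split; last first.
  by move=> fX; exists [:: f]; split=> [g|]; rewrite ?big_seq1 // inE => /eqP->.
move=> [s [sX ->]]; elim: s sX => [_|g s IH sX].
  exists Z, 0, 0; split=> //; by rewrite big_nil comp0m.
rewrite big_cons.
have [Y [u [v [XY ->]]]] : factors g by apply: sX; rewrite inE eqxx.
have [|Y' [u' [v' [XY' ->]]]] := IH.
  by move=> h hs; apply: sX; rewrite inE hs orbT.
have [S XS] := XD _ _ XY XY'.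
have [H1 H2 H3 H4 _] := bpP S.
exists S, (inl S \oc u + inr S \oc u'), (v \oc prl S + v' \oc prr S).
split=> //; rewrite compDl !compDr -!compA [prl S \oc (inl S \oc u)]compA.
rewrite [prl S \oc (inr S \oc u')]compA [prr S \oc (inl S \oc u)]compA.
rewrite [prr S \oc (inr S \oc u')]compA H1 H2 H3 H4 !comp0m !compm0 !comp1m.
by rewrite addr0 add0r.
Qed.

End FactorIdeal.

Section ConflationCategory.
Variables (M : precat) (conf : conf_class M).

Record conflation := Conflation {
  cf1 : M; cf2 : M; cf3 : M;
  cfi : hom cf1 cf2;
  cfp : hom cf2 cf3;
  cfP : conf cfi cfp }.

Section Hom.
Variables s t : conflation.

Definition triple := (hom (cf1 s) (cf1 t) * hom (cf2 s) (cf2 t) * hom (cf3 s) (cf3 t))%type.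

Definition commuting : pred triple := fun u =>
  (u.1.2 \oc cfi s == cfi t \oc u.1.1) && (u.2 \oc cfp s == cfp t \oc u.1.2).

Lemma commuting_zmod : zmod_closed commuting.
Proof.
split=> [|u v]; rewrite !unfold_in /= /commuting /=.
  by rewrite !comp0m !compm0 !eqxx.
move=> /andP[/eqP u1 /eqP u2] /andP[/eqP v1 /eqP v2].
by rewrite !compDl !compDr !compNm !compmN u1 u2 v1 v2 !eqxx.
Qed.

HB.instance Definition _ := GRing.isZmodClosed.Build triple commuting commuting_zmod.

Record chom := CHom { cval : triple; chomP : commuting cval }.

HB.instance Definition _ := [isSub for cval].
HB.instance Definition _ := [Choice of chom by <:].
HB.instance Definition _ := [SubChoice_isSubZmodule of chom by <:].

Lemma chom_comm (u : chom) :
  (cval u).1.2 \oc cfi s = cfi t \oc (cval u).1.1 /\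
  (cval u).2 \oc cfp s = cfp t \oc (cval u).1.2.
Proof. by have /andP[/eqP ? /eqP ?] := chomP u. Qed.

End Hom.

Definition ch1 s t (u : chom s t) : hom (cf1 s) (cf1 t) := (cval u).1.1.
Definition ch2 s t (u : chom s t) : hom (cf2 s) (cf2 t) := (cval u).1.2.
Definition ch3 s t (u : chom s t) : hom (cf3 s) (cf3 t) := (cval u).2.

Lemma cid_proof s : @commuting s s (idm _, idm _, idm _).
Proof. by rewrite /commuting /= !comp1m !compm1 !eqxx. Qed.

Definition cid s : chom s s := CHom (cid_proof s).

Lemma ccomp_proof r s t (v : chom s t) (u : chom r s) :
  @commuting r t (ch1 v \oc ch1 u, ch2 v \oc ch2 u, ch3 v \oc ch3 u).
Proof.
have [u1 u2] := chom_comm u; have [v1 v2] := chom_comm v.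
rewrite /commuting /= /ch1 /ch2 /ch3.
by rewrite -compA u1 compA v1 -compA eqxx -compA u2 compA v2 -compA eqxx.
Qed.

Definition ccomp r s t (v : chom s t) (u : chom r s) : chom r t :=
  CHom (ccomp_proof v u).

Lemma chom_eq s t (u v : chom s t) :
  ch1 u = ch1 v -> ch2 u = ch2 v -> ch3 u = ch3 v -> u = v.
Proof.
rewrite /ch1 /ch2 /ch3 => h1 h2 h3; apply: val_inj => /=.
by move: h1 h2 h3; case: (cval u) => [[? ?] ?]; case: (cval v) => [[? ?] ?] /= -> -> ->.
Qed.

Lemma ccomp1m s t (u : chom s t) : ccomp (cid t) u = u.
Proof. by apply: chom_eq; rewrite /ch1 /ch2 /ch3 /= comp1m. Qed.

Lemma ccompm1 s t (u : chom s t) : ccomp u (cid s) = u.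
Proof. by apply: chom_eq; rewrite /ch1 /ch2 /ch3 /= compm1. Qed.

Lemma ccompA q r s t (w : chom s t) (v : chom r s) (u : chom q r) :
  ccomp w (ccomp v u) = ccomp (ccomp w v) u.
Proof. by apply: chom_eq; rewrite /ch1 /ch2 /ch3 /= compA. Qed.

Lemma ccompDl r s t (v v' : chom s t) (u : chom r s) :
  ccomp (v + v') u = ccomp v u + ccomp v' u.
Proof. by apply: chom_eq; rewrite /ch1 /ch2 /ch3 /= compDl. Qed.

Lemma ccompDr r s t (v : chom s t) (u u' : chom r s) :
  ccomp v (u + u') = ccomp v u + ccomp v u'.
Proof. by apply: chom_eq; rewrite /ch1 /ch2 /ch3 /= compDr. Qed.

Definition conf_cat : precat :=
  @Precat conflation (fun s t => chom s t : zmodType) cid ccomp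
    ccomp1m ccompm1 ccompA ccompDl ccompDr.

Definition degreewise : conf_class conf_cat :=
  fun r s t (a : chom r s) (b : chom s t) =>
    [/\ conf (ch1 a) (ch1 b), conf (ch2 a) (ch2 b) & conf (ch3 a) (ch3 b)].

Definition split_conf (s : conf_cat) :=
  exists (r : hom (cf2 s) (cf1 s)) (q : hom (cf3 s) (cf2 s)),
    is_biproduct (cfi s) q r (cfp s).

End ConflationCategory.

Arguments degreewise {M} conf [A B D] _ _.
Arguments split_conf {M conf} s.

(** Additive bifunctors [C^op * C -> Ab]. *)
Record bifunctor (C : precat) := Bifunctor {
  bob :> C -> C -> zmodType;
  pull : forall (D D' A : C), hom D' D -> {additive bob D A -> bob D' A};
  push : forall (D A A' : C), hom A A' -> {additive bob D A -> bob D A'};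
  pull_id : forall D A (u : bob D A), pull A (idm D) u = u;
  push_id : forall D A (u : bob D A), push D (idm A) u = u;
  pull_comp : forall D D' D'' A (c : hom D' D) (c' : hom D'' D') (u : bob D A),
    pull A (c \oc c') u = pull A c' (pull A c u);
  push_comp : forall D A A' A'' (a' : hom A' A'') (a : hom A A') (u : bob D A),
    push D (a' \oc a) u = push D a' (push D a u);
  pull_push : forall D D' A A' (c : hom D' D) (a : hom A A') (u : bob D A),
    pull A' c (push D a u) = push D' a (pull A c u);
  pullD : forall D D' A (c c' : hom D' D) (u : bob D A),
    pull A (c + c') u = pull A c u + pull A c' u;
  pushD : forall D A A' (a a' : hom A A') (u : bob D A),
    push D (a + a') u = push D a u + push D a' u }.

Arguments pull {C} b {D D' A} _.
Arguments push {C} b {D A A'} _.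

Section Realization.
Variables (C : precat) (E : bifunctor C).

(** [s d x y] means that the sequence [x, y] belongs to the class realizing [d]. *)
Definition realization_rel :=
  forall D A : C, E D A -> forall B : C, hom A B -> hom B D -> Prop.

Definition equiv_seq (A D B B' : C) (x : hom A B) (y : hom B D)
    (x' : hom A B') (y' : hom B' D) :=
  exists b : hom B B', [/\ is_iso b, b \oc x = x' & y' \oc b = y].

Definition ext_morph (A D A' D' : C) (d : E D A) (d' : E D' A')
    (a : hom A A') (c : hom D D') := push E a d = pull E c d'.

Definition ext_dsum (A D A' D' : C) (SA : biproduct A A') (SD : biproduct D D')
    (d : E D A) (d' : E D' A') : E SD SA :=
  push E (inl SA) (pull E (prl SD) d) + push E (inr SA) (pull E (prr SD) d').

Variable s : realization_rel.

Definition eq_class_valued := forall (D A : C) (d : E D A),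
  exists (B : C) (x : hom A B) (y : hom B D),
    s d x y /\ forall (B' : C) (x' : hom A B') (y' : hom B' D),
      s d x' y' <-> equiv_seq x y x' y'.

Definition realizes_morphisms :=
  forall (A B D A' B' D' : C) (d : E D A) (d' : E D' A')
    (x : hom A B) (y : hom B D) (x' : hom A' B') (y' : hom B' D')
    (a : hom A A') (c : hom D D'),
    s d x y -> s d' x' y' -> ext_morph d d' a c ->
    exists b : hom B B', b \oc x = x' \oc a /\ c \oc y = y' \oc b.

Definition realizes_zero :=
  forall (A D : C) (S : biproduct A D), s (0 : E D A) (inl S) (prr S).

Definition realizes_sums :=
  forall (A B D A' B' D' : C) (d : E D A) (d' : E D' A')
    (x : hom A B) (y : hom B D) (x' : hom A' B') (y' : hom B' D')
    (SA : biproduct A A') (SB : biproduct B B') (SD : biproduct D D'),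
    s d x y -> s d' x' y' ->
    s (ext_dsum SA SD d d') (dsum SA SB x x') (dsum SB SD y y').

Definition ET3 :=
  forall (A B D A' B' D' : C) (d : E D A) (d' : E D' A')
    (x : hom A B) (y : hom B D) (x' : hom A' B') (y' : hom B' D')
    (a : hom A A') (b : hom B B'),
    s d x y -> s d' x' y' -> b \oc x = x' \oc a ->
    exists c : hom D D', ext_morph d d' a c /\ c \oc y = y' \oc b.

Definition ET3op :=
  forall (A B D A' B' D' : C) (d : E D A) (d' : E D' A')
    (x : hom A B) (y : hom B D) (x' : hom A' B') (y' : hom B' D')
    (b : hom B B') (c : hom D D'),
    s d x y -> s d' x' y' -> c \oc y = y' \oc b ->
    exists a : hom A A', ext_morph d d' a c /\ b \oc x = x' \oc a.

Definition ET4 :=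
  forall (A B D G F : C) (f : hom A B) (f' : hom B D) (g : hom B G) (g' : hom G F)
    (d : E D A) (d' : E F B),
    s d f f' -> s d' g g' ->
    exists (H : C) (h' : hom G H) (k : hom D H) (e : hom H F) (d'' : E H A),
      [/\ s d'' (g \oc f) h', k \oc f' = h' \oc g & e \oc h' = g'] /\
      [/\ s (push E f' d') k e, pull E k d'' = d & push E f d'' = pull E e d'].

Definition ET4op :=
  forall (A B D G F : C) (f' : hom D A) (f : hom A B) (g' : hom F B) (g : hom B G)
    (d : E B D) (d' : E G F),
    s d f' f -> s d' g' g ->
    exists (H : C) (h' : hom H A) (k : hom D H) (e : hom H F) (d'' : E G H),
      [/\ s d'' h' (g \oc f), h' \oc k = f' & f \oc h' = g' \oc e] /\
      [/\ s (pull E g' d) k e, push E e d'' = d' & push E k d = pull E g d''].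

End Realization.

Record extriangulated := Extriangulated {
  ecat :> precat;
  ecat_additive : is_additive ecat;
  extE : bifunctor ecat;
  realizes : realization_rel extE;
  realizes_class : eq_class_valued realizes;
  realizes_morphP : realizes_morphisms realizes;
  realizes_zeroP : realizes_zero realizes;
  realizes_sumsP : realizes_sums realizes;
  et3 : ET3 realizes;
  et3op : ET3op realizes;
  et4 : ET4 realizes;
  et4op : ET4op realizes }.

Arguments realizes C [D A] _ [B] _ _ : rename.

Section Extriangulated.
Variable C : extriangulated.

Definition econf : conf_class C := fun A B D x y =>
  exists d : extE C D A, realizes C d x y.

Definition eproj_mor (A B : C) (f : hom A B) :=
  forall (W : C) (u : extE C B W), pull (extE C) f u = 0.

Definition einj_mor (A B : C) (f : hom A B) :=
  forall (W : C) (u : extE C W A), push (extE C) f u = 0.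

Definition eproj (P : C) :=
  forall (B D : C) (y : hom B D), deflation econf y ->
    forall f : hom P D, exists g : hom P B, y \oc g = f.

Definition enough_eproj :=
  forall D : C, exists (P : C) (y : hom P D), eproj P /\ deflation econf y.

Record etriangle := ETriangle {
  t1 : C; t2 : C; t3 : C;
  tx : hom t1 t2;
  ty : hom t2 t3;
  tdelta : extE C t3 t1;
  tP : realizes C tdelta tx ty }.

Definition etriangle_morph (T T' : etriangle) (a : hom (t1 T) (t1 T'))
    (b : hom (t2 T) (t2 T')) (c : hom (t3 T) (t3 T')) :=
  [/\ b \oc tx T = tx T' \oc a, c \oc ty T = ty T' \oc b
    & ext_morph (tdelta T) (tdelta T') a c].

End Extriangulated.

(** [ext_fam E H i] is [E^i] for [1 <= i], with [E^1] equal to [E] on the nose;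
    its value at [0] is never used. *)
Definition ext_fam (C : precat) (E : bifunctor C) (H : nat -> bifunctor C) (i : nat) :=
  if i is j.+2 then H j else E.

Section ExactAt.
Variables U V W : zmodType.
Definition exact_at (f : U -> V) (g : V -> W) :=
  forall v, g v = 0 <-> exists u, v = f u.
End ExactAt.

Record higher_ext (C : extriangulated) := HigherExt {
  hext : nat -> bifunctor C;
  Ext := ext_fam (extE C) hext;
  (* the connecting maps [E^i(A, W) -> E^i.+1(D, W)] and [E^i(W, D) -> E^i.+1(W, A)] *)
  con1 : forall (i : nat) (T : etriangle C) (W : C),
    {additive Ext i.+1 (t1 T) W -> Ext i.+2 (t3 T) W};
  con2 : forall (i : nat) (T : etriangle C) (W : C),
    {additive Ext i.+1 W (t3 T) -> Ext i.+2 W (t1 T)};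
  con1_nat : forall i T (W W' : C) (w : hom W W') (u : Ext i.+1 (t1 T) W),
    con1 i T W' (push (Ext i.+1) w u) = push (Ext i.+2) w (con1 i T W u);
  con2_nat : forall i T (W W' : C) (w : hom W' W) (u : Ext i.+1 W (t3 T)),
    con2 i T W' (pull (Ext i.+1) w u) = pull (Ext i.+2) w (con2 i T W u);
  con1_morph : forall i (T T' : etriangle C) a b c (W : C),
    @etriangle_morph C T T' a b c -> forall u : Ext i.+1 (t1 T') W,
    con1 i T W (pull (Ext i.+1) a u) = pull (Ext i.+2) c (con1 i T' W u);
  con2_morph : forall i (T T' : etriangle C) a b c (W : C),
    @etriangle_morph C T T' a b c -> forall u : Ext i.+1 W (t3 T),
    con2 i T' W (push (Ext i.+1) c u) = push (Ext i.+2) a (con2 i T W u);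
  hext_exact1 : forall i (T : etriangle C) (W : C),
    exact_at (@pull _ (Ext i.+1) _ _ W (ty T)) (@pull _ (Ext i.+1) _ _ W (tx T)) /\
    exact_at (@pull _ (Ext i.+1) _ _ W (tx T)) (con1 i T W);
  hext_exact2 : forall i (T : etriangle C) (W : C),
    exact_at (@push _ (Ext i.+1) W _ _ (tx T)) (@push _ (Ext i.+1) W _ _ (ty T)) /\
    exact_at (@push _ (Ext i.+1) W _ _ (ty T)) (con2 i T W);
  hext_proj : forall i (A B : C) (f : hom A B), eproj_mor f ->
    forall (W : C) (u : Ext i.+1 B W), pull (Ext i.+1) f u = 0;
  hext_inj : forall i (A B : C) (f : hom A B), einj_mor f ->
    forall (W : C) (u : Ext i.+1 W A), push (Ext i.+1) f u = 0 }.

(** This is (n+2)-rigidity: vanishing in degrees [1] to [n+1]. *)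
Definition rigid (C : extriangulated) (H : higher_ext C) (n : nat) (X : C -> Prop) :=
  forall Y Y' : C, X Y -> X Y' ->
  forall i, (1 <= i <= n.+1)%N -> forall u : Ext H i Y Y', u = 0.

Section Modules.
Variable A : precat.

Record module := Module {
  mob :> A -> zmodType;
  mact : forall B D : A, hom B D -> {additive mob D -> mob B};
  mact_id : forall B (z : mob B), mact (idm B) z = z;
  mact_comp : forall B D E (g : hom D E) (f : hom B D) (z : mob E),
    mact (g \oc f) z = mact f (mact g z);
  mactD : forall B D (f g : hom B D) (z : mob D), mact (f + g) z = mact f z + mact g z }.

Record mhom (F G : module) := MHom {
  mapp :> forall B : A, {additive F B -> G B};
  mapp_nat : forall B D (f : hom B D) (z : F D), mapp B (mact F f z) = mact G f (mapp D z) }.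

(** Kernels and cokernels, hence exactness, of module maps are objectwise. *)
Definition mshort_exact (F G H : module) (u : mhom F G) (v : mhom G H) :=
  forall B : A, [/\ injective (u B), exact_at (u B) (v B)
                  & forall z : H B, exists w, z = v B w].

Definition miso (F G : module) (u : mhom F G) :=
  exists v : mhom G F, forall B : A, cancel (u B) (v B) /\ cancel (v B) (u B).

(** Top [u], bottom [v], left [p], right [q]. *)
Definition msquare (F G F' G' : module) (u : mhom F G) (v : mhom F' G')
    (p : mhom F F') (q : mhom G G') :=
  forall (B : A) (z : F B), v B (p B z) = q B (u B z).

Definition mid (F : module) : mhom F F :=
  @MHom F F (fun B => GRing.Additive.clone _ _ (@idfun (F B)) _)
    (fun B D f z => erefl).

Section Yoneda.
Variable Y : A.

Section Act.
Variables (B D : A) (f : hom B D).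
Definition yo_act (z : hom D Y) : hom B Y := z \oc f.
Lemma yo_act_additive : zmod_morphism yo_act.
Proof. by move=> z w; rewrite /yo_act compDl compNm. Qed.
HB.instance Definition _ :=
  GRing.isZmodMorphism.Build (hom D Y) (hom B Y) yo_act yo_act_additive.
End Act.

Definition yoneda : module :=
  @Module (fun B => hom B Y)
    (fun B D f => GRing.Additive.clone _ _ (yo_act f) _)
    (fun B z => compm1 z) (fun B D E g f z => compA z g f)
    (fun B D f g z => compDr z f g).

End Yoneda.
End Modules.

Section FunctorF.
Variables (C : extriangulated) (n : nat) (X : C -> Prop).

Notation E := (extE C).

Definition Xvee (m : nat) : precat := full_sub (vee (@econf C) X m).

Lemma eproj_mor0 (A B : C) : eproj_mor (0 : hom A B).
Proof. by move=> W u; apply: (@addrI _ (pull E 0 u)); rewrite -pullD !addr0. Qed.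

Lemma eproj_morB (A B : C) (f g : hom A B) :
  eproj_mor f -> eproj_mor g -> eproj_mor (f - g).
Proof.
by move=> f0 g0 W u; have := pullD (f - g) g u; rewrite addrNK f0 g0 addr0 => <-.
Qed.

Lemma eproj_mor_post (A B D : C) (g : hom B D) (f : hom A B) :
  eproj_mor f -> eproj_mor (g \oc f).
Proof. by move=> f0 W u; rewrite pull_comp f0. Qed.

Lemma eproj_mor_pre (A B D : C) (g : hom B D) (f : hom A B) :
  eproj_mor g -> eproj_mor (g \oc f).
Proof. by move=> g0 W u; rewrite pull_comp g0 raddf0. Qed.

(** Morphisms [f] of [X_n^vee] with [E(f,-) = 0] on all of [C]. *)
Definition proj_ideal : ideal (Xvee n) :=
  @Ideal (Xvee n) (fun A B f => @eproj_mor C (sval A) (sval B) f)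
    (fun A B => @eproj_mor0 (sval A) (sval B))
    (fun A B => @eproj_morB (sval A) (sval B))
    (fun A B D => @eproj_mor_post (sval A) (sval B) (sval D))
    (fun A B D => @eproj_mor_pre (sval A) (sval B) (sval D)).

Definition Xvee_stable : precat := quot_cat proj_ideal.

Lemma pull_repr (A B : Xvee n) (f : hom A B) (W : C) (u : E (sval B) W) :
  pull E (repr (cls proj_ideal f) : hom (sval A) (sval B)) u
  = pull E (f : hom (sval A) (sval B)) u.
Proof.
have := (imem_repr proj_ideal f : eproj_mor _) W u.
set g : hom (sval A) (sval B) := repr _ => fg0.
by have := pullD (g - (f : hom (sval A) (sval B))) f u; rewrite addrNK fg0 add0r.
Qed.

(** The functor induced on [Xvee_stable] by [E(-, M)]; by [pull_repr] its
    action does not depend on the choice of representatives. *)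
Section Ebar.
Variable M : C.

Definition ebar_act (B D : Xvee_stable) (q : hom B D) :
    {additive E (sval D) M -> E (sval B) M} :=
  pull E (repr q : hom (sval B) (sval D)).

Lemma ebar_id (B : Xvee_stable) (z : E (sval B) M) : ebar_act (idm B) z = z.
Proof. by rewrite /ebar_act pull_repr pull_id. Qed.

Lemma ebar_comp (B D G : Xvee_stable) (g : hom D G) (f : hom B D) (z : E (sval G) M) :
  ebar_act (g \oc f) z = ebar_act f (ebar_act g z).
Proof. by rewrite /ebar_act pull_repr pull_comp. Qed.

Lemma ebarD (B D : Xvee_stable) (f g : hom B D) (z : E (sval D) M) :
  ebar_act (f + g) z = ebar_act f z + ebar_act g z.
Proof.
have -> : f + g = cls proj_ideal (repr f + repr g) by rewrite clsD !cls_repr.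
by rewrite /ebar_act pull_repr pullD.
Qed.

Definition Ebar : module Xvee_stable :=
  @Module Xvee_stable (fun B => E (sval B) M) ebar_act ebar_id ebar_comp ebarD.

End Ebar.

Lemma Ebar_map_nat (M N : C) (h : hom M N) (B D : Xvee_stable) (f : hom B D)
    (z : Ebar M D) :
  push E h (mact (Ebar M) f z) = mact (Ebar N) f (push E h z).
Proof. by rewrite /= /ebar_act pull_push. Qed.

Definition Ebar_map (M N : C) (h : hom M N) : mhom (Ebar M) (Ebar N) :=
  @MHom _ (Ebar M) (Ebar N) (fun B => push E h) (@Ebar_map_nat M N h).

Definition Xideal : ideal (Xvee n.+1) := factor_ideal (fun A : Xvee n.+1 => X (sval A)).

Definition M1 : precat := quot_cat Xideal.

Definition F_ob (M : M1) : module Xvee_stable := Ebar (sval M).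

(** For rigid [X] this does not depend on the representative, see [F_hom_cls]. *)
Definition F_hom (M N : M1) (q : hom M N) : mhom (F_ob M) (F_ob N) :=
  Ebar_map (repr q : hom (sval M) (sval N)).

Definition inR (G : module Xvee_stable) :=
  exists (Y0 Y1 : Xvee_stable) (u : mhom (yoneda Y0) (yoneda Y1)) (v : mhom (yoneda Y1) G),
    X (sval Y0) /\
    forall B : Xvee_stable, exact_at (u B) (v B) /\ forall z : G B, exists w, z = v B w.

Definition R_conf (G1 G2 G3 : module Xvee_stable) (u : mhom G1 G2) (v : mhom G2 G3) :=
  [/\ inR G1, inR G2, inR G3 & mshort_exact u v].

Definition eps_F : conf_class M1 :=
  fun A B D a b => mshort_exact (F_hom a) (F_hom b).

End FunctorF.

Arguments eps_F {C} n X [A B D] _ _.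
Arguments F_ob {C n X} M.
Arguments F_hom {C n X M N} q.

Section FHomCls.
Variables (C : extriangulated) (H : higher_ext C) (n : nat) (X : C -> Prop).
Hypothesis Xrigid : rigid H n X.

Lemma Ext_vee_X (m : nat) (K : C) : coresolution (@econf C) X m K ->
  forall i, (i + m <= n)%N -> forall Y, X Y -> forall u : Ext H i.+1 K Y, u = 0.
Proof.
elim=> {m K} [K Y XY [f [g [gf fg]]] i im Z XZ u|m K Y K' x y XY [d dxy] _ IH i im Z XZ u].
  rewrite addn0 in im.
  rewrite -[u]pull_id -gf pull_comp.
  by rewrite (Xrigid XY XZ (i := i.+1) _ (pull (Ext H i.+1) g u)) ?raddf0 //= ltnS.
pose T := ETriangle dxy.
have [_ ex] := hext_exact1 H i T Z.
have [v uv] := (ex u).1 (IH i.+1 (eq_ind _ (fun k => (k <= n)%N) im _ (addnS _ _))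
                          Z XZ (con1 H i T Z u)).
rewrite uv (Xrigid XY XZ (i := i.+1) _ v) ?raddf0 //= ltnS.
by apply: leq_trans im; apply: leq_addr.
Qed.

Lemma F_hom_cls (M N : M1 n X) (h : hom (sval M) (sval N)) (B : Xvee_stable n X)
    (z : F_ob M B) :
  F_hom (cls (Xideal n X) h : hom M N) B z = push (extE C) h z.
Proof.
have [s [sX sE]] := imem_repr (Xideal n X) (h : hom (M : Xvee X n.+1) N).
rewrite /F_hom /=; set g := repr _ in sE *.
have f0 (f : hom (sval M) (sval N)) :
    @factors (Xvee X n.+1) (fun A : Xvee X n.+1 => X (sval A)) M N f ->
    push (extE C) f z = 0.
  move=> [Y [u [v [XY ->]]]]; rewrite push_comp.
  case: (svalP B) => m mn mB.
  rewrite (Ext_vee_X mB (i := 0) _ XY (push (extE C) u z)) ?raddf0 //.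
suff s0 : push (extE C) ((g : hom (sval M) (sval N)) - h) z = 0.
  by have := pushD ((g : hom (sval M) (sval N)) - h) h z; rewrite addrNK s0 add0r.
rewrite sE; elim: s {sE} sX => [_|f s IH sX].
  rewrite big_nil; apply: (@addrI _ (push (extE C) 0 z)).
  by rewrite -pushD !addr0.
rewrite big_cons pushD f0 ?IH ?addr0 //.
  by move=> k ks; apply: sX; rewrite inE ks orbT.
by apply: sX; rewrite inE eqxx.
Qed.

End FHomCls.

(* Main.v *)
From HB Require Import structures.
From mathcomp Require Import all_boot ssralg.
Require Import Defs.

Set Implicit Arguments.
Unset Strict Implicit.
Unset Printing Implicit Defensive.

Import GRing.Theory.
Local Open Scope ring_scope.

(** Everything reduces to two facts: [M1] is an exact category, and split
    epimorphisms of [M1] come from split deflations.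

    The first assertions about conflations hold over every exact category. A
    morphism [f] from [E1 -> E2 -> E3] to [F1 -> F2 -> F3] factors through a split
    conflation iff its last component lifts to [F2] ([null_split_cover],
    [null_ideal]). Split conflations therefore behave like contractible complexes:
    a conflation is covered by the split conflation on its first two terms
    ([split_cover]) and embedded into the one on its last two ([split_hull]), with
    split kernel and cokernel, which gives [split_pseudo_cluster_tilting]. In the
    quotient a morphism is its last component modulo liftable ones, so that
    kernels and cokernels can be written down with a pullback of [F2 -> F3]
    ([kernel_conflation], [cokernel_conflation]); unwinding what it means for them
    to vanish shows that monomorphisms are kernels and epimorphisms cokernels
    ([quot_split_abelian]).

    To see that [M1] is exact, the coresolution [T -> T0 -> T1] of an object
    presents [F T] by the class of that conflation, because [E(K, T0) = 0] for [K]
    in the stable category; hence [F] is fully faithful ([F_faithful], [F_full]),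
    and morphisms of [M1] can be handled as additive natural relations between
    extension groups. The decisive point is [eps_realize]: up to isomorphism every
    conflation of [M1] is the image of a conflation [A -> S -> Q] of the
    extriangulated category whose class is killed by all maps from [A] to [X]. The
    latter condition is inherited by pushouts and pullbacks, and the horseshoe
    lemma [cores_extension] keeps their middle terms in the class of objects with
    coresolutions of length at most [n + 1]. So [eps_pushout] and [eps_pullback]
    are obtained from pushouts and pullbacks of extensions, and closure under
    composition follows by diagram chasing ([eps_exact]).

    Finally, if [[b]] has a section, then [(b, g)] has a section for some map [g]
    from an object of [X]; adding a projective cover gives a split deflation
    [(b, g, p)] ([split_epi_triangle]). Its kernel is a direct summand of an object
    with a coresolution of length at most [n + 1], so by the Schanuel argument
    [cores_summand] it has one too. This yields both weak idempotent completeness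
    and the description of the split conflations. *)

(** * Additive categories *)

Section Additive.
Variable C : precat.

(** Rewriting with a composite inside a right-associated composition. *)
Lemma comp_assoc (T A B D : C) (g : hom B D) (f : hom A B) (h : hom A D) :
  g \oc f = h -> forall t : hom T A, g \oc (f \oc t) = h \oc t.
Proof. by move=> <- t; rewrite compA. Qed.

Lemma is_iso_idm (A : C) : is_iso (idm A).
Proof. by exists (idm A); rewrite comp1m. Qed.

Lemma is_biproduct_sym (A B S : C) (i1 : hom A S) (i2 : hom B S)
    (p1 : hom S A) (p2 : hom S B) :
  is_biproduct i1 i2 p1 p2 -> is_biproduct i2 i1 p2 p1.
Proof. by case=> *; split=> //; rewrite addrC. Qed.

Lemma pr_eq (A B S : C) (i1 : hom A S) (i2 : hom B S) (p1 : hom S A) (p2 : hom S B) :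
  is_biproduct i1 i2 p1 p2 -> forall T (u v : hom T S),
  p1 \oc u = p1 \oc v -> p2 \oc u = p2 \oc v -> u = v.
Proof.
by case=> _ _ _ _ e T u v e1 e2; rewrite -[u]comp1m -[v]comp1m -e !compDl -!compA e1 e2.
Qed.

Lemma in_eq (A B S : C) (i1 : hom A S) (i2 : hom B S) (p1 : hom S A) (p2 : hom S B) :
  is_biproduct i1 i2 p1 p2 -> forall T (u v : hom S T),
  u \oc i1 = v \oc i1 -> u \oc i2 = v \oc i2 -> u = v.
Proof.
by case=> _ _ _ _ e T u v e1 e2; rewrite -[u]compm1 -[v]compm1 -e !compDr !compA e1 e2.
Qed.

(** Shearing the first injection along [h : A -> B]. *)
Lemma is_biproduct_shear (A B S : C) (i1 : hom A S) (i2 : hom B S)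
    (p1 : hom S A) (p2 : hom S B) (h : hom A B) :
  is_biproduct i1 i2 p1 p2 ->
  is_biproduct (i1 + i2 \oc h) i2 p1 (p2 - h \oc p1).
Proof.
case=> e11 e22 e12 e21 e; split.
- by rewrite compDr e11 compA e12 comp0m addr0.
- by rewrite compDl compNm -compA e12 compm0 subr0.
- exact: e12.
- by rewrite compDr !compDl !compNm -!compA e21 e11 (comp_assoc e22) (comp_assoc e12)
    compm1 comp1m comp0m compm0 add0r subr0 addNr.
- by rewrite compDl compDr compmN -e addrACA -compA subrr addr0.
Qed.

Lemma biproductE (A B : C) (S : biproduct A B) :
  [/\ prl S \oc inl S = idm A, prr S \oc inr S = idm B, prl S \oc inr S = 0,
      prr S \oc inl S = 0 & inl S \oc prl S + inr S \oc prr S = idm S].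
Proof. exact: bpP. Qed.

Lemma copair_inl (A B T : C) (S : biproduct A B) (f : hom A T) (g : hom B T) :
  copair S f g \oc inl S = f.
Proof.
have [e1 _ _ e2 _] := biproductE S.
by rewrite compDl -!compA e1 e2 compm1 compm0 addr0.
Qed.

Lemma copair_inr (A B T : C) (S : biproduct A B) (f : hom A T) (g : hom B T) :
  copair S f g \oc inr S = g.
Proof.
have [_ e1 e2 _ _] := biproductE S.
by rewrite compDl -!compA e1 e2 compm1 compm0 add0r.
Qed.

Definition pairing (A B T : C) (S : biproduct A B) (f : hom T A) (g : hom T B) : hom T S :=
  inl S \oc f + inr S \oc g.

Lemma prl_pair (A B T : C) (S : biproduct A B) (f : hom T A) (g : hom T B) :
  prl S \oc pairing S f g = f.
Proof.
have [e1 _ e2 _ _] := biproductE S.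
by rewrite compDr !compA e1 e2 comp1m comp0m addr0.
Qed.

Lemma prr_pair (A B T : C) (S : biproduct A B) (f : hom T A) (g : hom T B) :
  prr S \oc pairing S f g = g.
Proof.
have [_ e1 _ e2 _] := biproductE S.
by rewrite compDr !compA e1 e2 comp1m comp0m add0r.
Qed.

Lemma copair_pair (A B T U : C) (S : biproduct A B) (f : hom T A) (g : hom T B)
    (u : hom A U) (v : hom B U) :
  copair S u v \oc pairing S f g = u \oc f + v \oc g.
Proof. by rewrite compDl -!compA prl_pair prr_pair. Qed.

Lemma pairP (A B T : C) (S : biproduct A B) (u v : hom T S) :
  prl S \oc u = prl S \oc v -> prr S \oc u = prr S \oc v -> u = v.
Proof. exact: (pr_eq (bpP S)). Qed.

Lemma copairP (A B T : C) (S : biproduct A B) (u v : hom S T) :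
  u \oc inl S = v \oc inl S -> u \oc inr S = v \oc inr S -> u = v.
Proof. exact: (in_eq (bpP S)). Qed.

Section Dsum.
Variables (A B A' B' : C) (S : biproduct A B) (S' : biproduct A' B').
Variables (f : hom A A') (g : hom B B').

Lemma prl_dsum : prl S' \oc dsum S S' f g = f \oc prl S.
Proof. by rewrite /dsum -!compA prl_pair. Qed.

Lemma prr_dsum : prr S' \oc dsum S S' f g = g \oc prr S.
Proof. by rewrite /dsum -!compA prr_pair. Qed.

Lemma dsum_inl : dsum S S' f g \oc inl S = inl S' \oc f.
Proof.
have [e1 _ _ e2 _] := biproductE S.
by rewrite compDl -!compA e1 e2 !compm0 compm1 addr0.
Qed.

Lemma dsum_inr : dsum S S' f g \oc inr S = inr S' \oc g.
Proof.
have [_ e1 e2 _ _] := biproductE S.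
by rewrite compDl -!compA e1 e2 !compm0 compm1 add0r.
Qed.

End Dsum.

Definition biproduct_sym (A B : C) (S : biproduct A B) : biproduct B A :=
  Biproduct (is_biproduct_sym (bpP S)).

Lemma kernel_of_mono (A B K : C) (f : hom A B) (k : hom K A) :
  f \oc k = 0 -> (forall T (t : hom T A), f \oc t = 0 -> exists u, k \oc u = t) ->
  (forall T (u : hom T K), k \oc u = 0 -> u = 0) -> is_kernel f k.
Proof.
move=> fk kL km; split=> // T t /kL[u uE]; exists u; split=> // v vE.
by apply/eqP; rewrite -subr_eq0; apply/eqP/km; rewrite compDr compmN uE vE subrr.
Qed.

Lemma cokernel_of_epi (A B K : C) (f : hom A B) (k : hom B K) :
  k \oc f = 0 -> (forall T (t : hom B T), t \oc f = 0 -> exists u, u \oc k = t) ->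
  (forall T (u : hom K T), u \oc k = 0 -> u = 0) -> is_cokernel f k.
Proof.
move=> fk kL km; split=> // T t /kL[u uE]; exists u; split=> // v vE.
by apply/eqP; rewrite -subr_eq0; apply/eqP/km; rewrite compDl compNm uE vE subrr.
Qed.

Lemma kernel_iso (A B K K' : C) (f : hom A B) (k : hom K A) (k' : hom K' A) :
  is_kernel f k -> is_kernel f k' -> exists h : hom K' K, is_iso h /\ k \oc h = k'.
Proof.
move=> [fk kU] [fk' kU']; have [h [hE _]] := kU _ _ fk'; have [g [gE _]] := kU' _ _ fk.
exists h; split=> //; exists g; split.
  have [u [_ uU]] := kU' _ _ fk'.
  by rewrite -(uU (idm _)) ?compm1 //; apply/esym/uU; rewrite compA gE hE.
have [u [_ uU]] := kU _ _ fk.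
by rewrite -(uU (idm _)) ?compm1 //; apply/esym/uU; rewrite compA hE gE.
Qed.

Lemma is_zeroP (Z : C) : idm Z = 0 -> is_zero Z.
Proof.
move=> z A; split=> f g.
  by rewrite -[f]comp1m -[g]comp1m z !comp0m.
by rewrite -[f]compm1 -[g]compm1 z !compm0.
Qed.

Lemma to_zero (Z : C) : is_zero Z -> forall A (f : hom A Z), f = 0.
Proof. by move=> z A f; apply: (z A).1. Qed.

End Additive.

(** * Conflations of an exact category *)

Section ExactCategory.
Variables (M : precat) (conf : conf_class M) (ex : is_exact conf).

Section OneConflation.
Variables (A B D : M) (x : hom A B) (y : hom B D) (xy : conf x y).

Lemma conf0 : y \oc x = 0.
Proof. by have [[]] := exact_kercoker ex xy. Qed.

Lemma conf_lift T (t : hom T B) : y \oc t = 0 -> exists u, x \oc u = t.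
Proof.
by move=> yt; have [[_ /(_ _ _ yt)[u [ut _]]] _] := exact_kercoker ex xy; exists u.
Qed.

Lemma conf_mono : mono x.
Proof.
move=> T u v e.
have [[_ k] _] := exact_kercoker ex xy.
have [|w [_ wU]] := k T (x \oc v); first by rewrite compA conf0 comp0m.
by rewrite -(wU u e) -(wU v).
Qed.

Lemma conf_epi : epi y.
Proof.
move=> T u v e.
have [_ [_ k]] := exact_kercoker ex xy.
have [|w [_ wU]] := k T (v \oc y); first by rewrite -compA conf0 compm0.
by rewrite -(wU u e) -(wU v).
Qed.

End OneConflation.

Lemma deflation_kernel (K K' A B : M) (k' : hom K' A) (y : hom A B) (k : hom K A) :
  conf k' y -> y \oc k = 0 -> (forall T (t : hom T A), y \oc t = 0 ->
  exists u, k \oc u = t) -> mono k -> conf k y.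
Proof.
move=> c yk kL km.
have [u uE] := conf_lift c yk; have [v vE] := kL _ _ (conf0 c).
have vu : v \oc u = idm K by apply: km; rewrite compA vE uE compm1.
have uv : u \oc v = idm K' by apply: (conf_mono c); rewrite compA uE vE compm1.
apply: (exact_isoclosed ex c (a := v) (b := idm A) (d := idm B)).
- by exists u.
- exact: is_iso_idm.
- exact: is_iso_idm.
- by rewrite comp1m vE.
- by rewrite comp1m compm1.
Qed.

(** Any pullback of a deflation is a deflation, not only the chosen one. *)
Lemma pullback_conf (B D B' D' K : M) (p : hom B D) (f : hom D' D)
    (p' : hom B' D') (f' : hom B' B) (k : hom K B') :
  deflation conf p -> p \oc f' = f \oc p' ->
  (forall T (u : hom T B) (v : hom T D'), p \oc u = f \oc v ->
    exists w, f' \oc w = u /\ p' \oc w = v) ->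
  (forall T (u v : hom T B'), f' \oc u = f' \oc v -> p' \oc u = p' \oc v -> u = v) ->
  p' \oc k = 0 -> (forall T (t : hom T B'), p' \oc t = 0 -> exists u, k \oc u = t) ->
  mono k -> conf k p'.
Proof.
move=> dp sq pbL pbU pk kL km.
have [B2 [p2 [f2 [[sq2 pb2] [K2 [k2 c2]]]]]] := exact_pullback ex f dp.
have [w [[w1 w2] wU]] := pb2 _ _ _ sq.
have [v [v1 v2]] := pbL _ _ _ sq2.
have vw : v \oc w = idm B'.
  by apply: pbU; rewrite compA ?v1 ?v2 ?w1 ?w2 compm1.
have wv : w \oc v = idm B2.
  have [z [_ zU]] := pb2 _ _ _ sq2.
  rewrite -(zU (idm B2)) ?compm1 //; apply/esym/zU.
  by rewrite !compA w1 w2.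
have c3 : conf (v \oc k2) p'.
  apply: (exact_isoclosed ex c2 (a := idm K2) (b := v) (d := idm D')).
  - exact: is_iso_idm.
  - by exists w.
  - exact: is_iso_idm.
  - by rewrite compm1.
  - by rewrite comp1m v2.
exact: (deflation_kernel c3).
Qed.

Lemma conf_idm (A Z : M) : is_zero Z -> conf (idm A) (0 : hom A Z).
Proof.
move=> z; have [D [y c]] := exact_inf_id ex A.
have y0 : y = 0 by rewrite -[y]compm1 (conf0 c).
have D0 : is_zero D.
  by apply: is_zeroP; apply: (conf_epi c); rewrite y0 !compm0.
apply: (exact_isoclosed ex c (a := idm A) (b := idm A) (d := 0)).
- exact: is_iso_idm.
- exact: is_iso_idm.
- by exists 0; split; rewrite ?(to_zero z (idm Z)) ?(to_zero D0 (idm D)) comp0m.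
- by rewrite compm1.
- by rewrite comp0m comp0m.
Qed.

Lemma conf_0idm (A Z : M) : is_zero Z -> conf (0 : hom Z A) (idm A).
Proof.
move=> z; have [D [y c]] := exact_def_id ex A.
apply: (deflation_kernel c); first by rewrite comp1m.
- by move=> T t; rewrite comp1m => ->; exists 0; rewrite comp0m.
- by move=> T u v _; apply: (z T).1.
Qed.

(** Split sequences are pullbacks of [A -> 0]. *)
Lemma conf_biproduct (A B S : M) (i1 : hom A S) (i2 : hom B S)
    (p1 : hom S A) (p2 : hom S B) : is_biproduct i1 i2 p1 p2 -> conf i1 p2.
Proof.
move=> bp; have [e11 e22 e12 e21 e] := bp.
have [[Z z] _] := exact_additive ex.
apply: (@pullback_conf A Z S B A (0 : hom A Z) (0 : hom B Z) p2 p1) => //.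
- by exists A, (idm A); apply: conf_idm.
- by apply: (z S).1.
- move=> T u v _; exists (i1 \oc u + i2 \oc v).
  by rewrite !compDr !compA e11 e22 e12 e21 !comp0m !comp1m addr0 add0r.
- by move=> T u v; apply: (pr_eq bp).
- move=> T t p2t; exists (p1 \oc t).
  by rewrite -[RHS]comp1m -e compDl -!compA p2t compm0 addr0.
- by move=> T u v /(congr1 (fun h => p1 \oc h)); rewrite !compA e11 !comp1m.
Qed.

Section Pullback.
Variables (F1 F2 F3 E3 : M) (i : hom F1 F2) (p : hom F2 F3) (c : conf i p) (f : hom E3 F3).

(** Kernels are preserved: a map into the pullback that dies in [E3] is a map into
    [F2] that dies in [F3]. *)
Lemma pullback_conflation : exists (G : M) (j : hom F1 G) (g : hom G E3) (h : hom G F2),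
  [/\ conf j g, h \oc j = i, p \oc h = f \oc g &
      (forall T (u : hom T F2) (v : hom T E3), p \oc u = f \oc v ->
        exists w, h \oc w = u /\ g \oc w = v)].
Proof.
have [|G [g [h [[sq pb] [K [k ck]]]]]] := exact_pullback ex (p := p) f; first by exists F1, i.
have [|j [[j1 j2] _]] := pb F1 i 0; first by rewrite compm0 (conf0 c).
exists G, j, g, h; split=> //; last first.
  by move=> T u v /pb[w [wE _]]; exists w.
apply: (deflation_kernel ck) => //.
- move=> T t gt; have [|u uE] := conf_lift c (t := h \oc t).
    by rewrite compA sq -compA gt compm0.
  exists u; have [|w [_ wU]] := pb T (h \oc t) 0; first by rewrite compm0 compA sq -compA gt compm0.
  by rewrite -(wU t) // -(wU (j \oc u)) // !compA j1 j2 comp0m.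
- move=> T u v /(congr1 (fun t => h \oc t)); rewrite !compA j1.
  exact: (conf_mono c).
Qed.

End Pullback.

Section Sums.
Variables (F1 F2 F3 : M) (i : hom F1 F2) (p : hom F2 F3) (c : conf i p).

(** [p + 1] is the pullback of [p] along the first projection. *)
Lemma dsum_idm_conf (E : M) (S : biproduct F2 E) (U : biproduct F3 E) :
  conf (inl S \oc i) (dsum S U p (idm E)).
Proof.
have [s1 _ _ s4 _] := biproductE S.
have d1 := prl_dsum S U p (idm E); have d2 := prr_dsum S U p (idm E).
rewrite comp1m in d2.
apply: (@pullback_conf F2 F3 S U F1 p (prl U) _ (prl S)).
- by exists F1, i.
- by rewrite d1.
- move=> T u v e; exists (pairing S u (prr U \oc v)); rewrite prl_pair; split=> //.
  by apply: pairP; rewrite compA ?d1 ?d2 -?compA ?prl_pair ?prr_pair.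
- move=> T u v e1 /(congr1 (fun t => prr U \oc t)); rewrite !compA d2.
  exact: pairP.
- by apply: pairP; rewrite !compA ?d1 ?d2 ?s4 -?compA ?(comp_assoc s1) ?comp1m ?(conf0 c)
    ?comp0m ?compm0.
- move=> T t dt.
  have [|u uE] := conf_lift c (t := prl S \oc t).
    by rewrite compA -d1 -compA dt compm0.
  exists u; apply: pairP; rewrite -compA uE compA ?s1 ?s4 ?comp1m //.
  by rewrite comp0m -d2 -compA dt compm0.
- move=> T u v /(congr1 (fun t => prl S \oc t)); rewrite !compA s1 comp1m.
  exact: (conf_mono c).
Qed.

(** [(p, f) : F2 + E -> F3] is [p + 1] followed by a split deflation. *)
Lemma copair_deflation (E : M) (f : hom E F3) (S : biproduct F2 E) :
  deflation conf (copair S p f).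
Proof.
have [_ aM] := exact_additive ex.
have [U] := aM F3 E.
have -> : copair S p f = (prl U + f \oc prr U) \oc dsum S U p (idm E).
  by rewrite compDl -compA prl_dsum prr_dsum comp1m.
apply: (exact_def_comp ex); first by exists F1, (inl S \oc i); apply: dsum_idm_conf.
have := is_biproduct_shear (- f) (is_biproduct_sym (bpP U)).
rewrite compNm opprK => bp.
by exists E, (inr U + inl U \oc (- f)); apply: (conf_biproduct bp).
Qed.

End Sums.

Lemma dsum_conf (A B D A' B' D' : M) (x : hom A B) (y : hom B D) (x' : hom A' B')
    (y' : hom B' D') (SA : biproduct A A') (SB : biproduct B B') (SD : biproduct D D') :
  conf x y -> conf x' y' -> conf (dsum SA SB x x') (dsum SB SD y y').
Proof.
move=> c c'; have [_ aM] := exact_additive ex; have [U] := aM D B'.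
pose SD' := biproduct_sym SD; pose U' := biproduct_sym U.
have [K [k ck]] : deflation conf (dsum SB SD y y').
  have -> : dsum SB SD y y' = dsum U' SD' y' (idm D) \oc dsum SB U y (idm B').
    apply: pairP; rewrite compA.
      by rewrite prl_dsum (prr_dsum U' SD') comp1m (prl_dsum SB U).
    by rewrite prr_dsum (prl_dsum U' SD') -compA (prr_dsum SB U) comp1m.
  apply: (exact_def_comp ex).
    exists A, (inl SB \oc x); exact: (dsum_idm_conf c SB U).
  exists A', (inl U' \oc x'); exact: (dsum_idm_conf c' U' SD').
apply: (deflation_kernel ck).
- apply: pairP; rewrite compm0 compA.
    by rewrite prl_dsum -compA prl_dsum compA (conf0 c) comp0m.
  by rewrite prr_dsum -compA prr_dsum compA (conf0 c') comp0m.
- move=> T t dt.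
  have [|u uE] := conf_lift c (t := prl SB \oc t).
    by rewrite compA -(prl_dsum SB SD y y') -compA dt compm0.
  have [|v vE] := conf_lift c' (t := prr SB \oc t).
    by rewrite compA -(prr_dsum SB SD y y') -compA dt compm0.
  exists (pairing SA u v).
  by apply: pairP; rewrite compA ?prl_dsum ?prr_dsum -compA ?prl_pair ?prr_pair.
- move=> T u v e; apply: pairP; [apply: (conf_mono c) | apply: (conf_mono c')].
    by rewrite !compA -(prl_dsum SA SB x x') -!compA e.
  by rewrite !compA -(prr_dsum SA SB x x') -!compA e.
Qed.

End ExactCategory.

(** * Split conflations in the category of conflations *)

Section ConflationCategory.
Variables (M : precat) (conf : conf_class M) (ex : is_exact conf).

Notation CC := (conf_cat conf).
Notation split := (@split_conf M conf).

Lemma ch3B (s t : CC) (u v : hom s t) : ch3 (u - v) = ch3 u - ch3 v.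
Proof. by []. Qed.

Lemma ch3M (r s t : CC) (v : hom s t) (u : hom r s) : ch3 (v \oc u) = ch3 v \oc ch3 u.
Proof. by []. Qed.

Lemma cfp_cfi (s : CC) : cfp s \oc cfi s = 0.
Proof. exact: (conf0 ex (cfP s)). Qed.

Lemma chom_of_right_square (s t : CC) (f2 : hom (cf2 s) (cf2 t)) (f3 : hom (cf3 s) (cf3 t)) :
  f3 \oc cfp s = cfp t \oc f2 -> exists u : hom s t, ch2 u = f2 /\ ch3 u = f3.
Proof.
move=> e; have [|f1 f1E] := conf_lift ex (cfP t) (t := f2 \oc cfi s).
  by rewrite compA -e -compA cfp_cfi compm0.
have uP : @commuting _ _ s t (f1, f2, f3) by rewrite /commuting /= f1E e !eqxx.
by exists (CHom uP).
Qed.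

(** Morphisms of conflations that are null-homotopic; by exactness a lift of
    the last component along [cfp t] is the whole homotopy. *)
Definition null (s t : CC) (u : hom s t) :=
  exists h : hom (cf3 s) (cf2 t), ch3 u = cfp t \oc h.

Lemma splitP (s : CC) : split s <-> exists q : hom (cf3 s) (cf2 s), cfp s \oc q = idm _.
Proof.
split=> [[r [q []]]|[q e]]; first by exists q.
have [|r rE] := conf_lift ex (cfP s) (t := idm _ - q \oc cfp s).
  by rewrite compDr compmN compA e comp1m compm1 subrr.
exists r, q; split=> //.
- apply: (conf_mono ex (cfP s)).
  by rewrite compA rE compDl compNm comp1m -compA cfp_cfi !compm0 compm1 subr0.
- apply: (conf_mono ex (cfP s)).
  by rewrite compA rE compDl compNm comp1m -compA e compm0 compm1 subrr.
- exact: cfp_cfi.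
- by rewrite rE addrNK.
Qed.

Lemma split_retract (s t : CC) (u : hom s t) (v : hom t s) :
  v \oc u = idm s -> split t -> split s.
Proof.
move=> vu /splitP[q qE]; apply/splitP; exists (ch2 v \oc q \oc ch3 u).
rewrite !compA -(chom_comm v).2 -!compA (comp_assoc qE) comp1m.
by rewrite -[LHS](ch3M v u) vu.
Qed.

Definition split_conflation (A B : M) (S : biproduct A B) : CC :=
  Conflation (conf_biproduct ex (bpP S)).

Lemma split_split_conflation (A B : M) (S : biproduct A B) : split (split_conflation S).
Proof. by exists (prl S), (inr S); apply: bpP. Qed.

Lemma split_left (A Z : M) (z : is_zero Z) : split (Conflation (conf_idm ex A z)).
Proof.
apply/splitP; exists 0 => /=.
by rewrite comp0m (to_zero z (idm Z)).
Qed.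

Lemma split_right (A Z : M) (z : is_zero Z) : split (Conflation (conf_0idm ex A z)).
Proof. by apply/splitP; exists (idm A); rewrite /= comp1m. Qed.

(** [(1, (i, 1), p)] maps [A -> A + B -> B] onto [A -> B -> D], with kernel
    [0 -> A -> A]. *)
Section Precover.
Variables (s : CC) (S : biproduct (cf1 s) (cf2 s)).

Lemma split_cover_proof : @commuting _ _ (split_conflation S) s
  (idm _, copair S (cfi s) (idm _), cfp s).
Proof.
rewrite /commuting /= copair_inl compm1 eqxx /=; apply/eqP/(copairP (S := S)).
  rewrite -!compA copair_inl cfp_cfi.
  by have [_ _ _ -> _] := biproductE S; rewrite compm0.
rewrite -!compA copair_inr compm1.
by have [_ -> _ _ _] := biproductE S; rewrite compm1.
Qed.

Definition split_cover : hom (split_conflation S) s := CHom split_cover_proof.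

Lemma null_split_cover (t : CC) (u : hom t s) :
  null u <-> exists v : hom t (split_conflation S), u = split_cover \oc v.
Proof.
split=> [[h hE]|[v vE]].
  have [|k kE] := conf_lift ex (cfP s) (t := ch2 u - h \oc cfp t).
    by rewrite compDr compmN compA -hE (chom_comm u).2 subrr.
  have [|v [v2 v3]] := @chom_of_right_square t (split_conflation S) (pairing S k (h \oc cfp t)) h.
    by rewrite /= prr_pair.
  have [ui up] := chom_comm u.
  exists v; apply: chom_eq.
  - rewrite /= -[LHS]/(ch1 u); apply: (conf_mono ex (cfP s)).
    have := congr1 (fun g => copair S (cfi s) (idm _) \oc g) (chom_comm v).1.
    rewrite [(cval v).1.2]v2 /= compA copair_pair (compA _ (inl S)) copair_inl kE => e.
    by rewrite /= /ch1 /= comp1m -e comp1m addrNK ui.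
  - by rewrite /ch2 /= v2 copair_pair kE comp1m addrNK.
  - by rewrite /ch3 /= v3 -hE.
exists (ch3 v); by rewrite vE.
Qed.

Lemma split_cover_conflation : exists (r : CC) (a : hom r (split_conflation S)),
  split r /\ degreewise conf a split_cover.
Proof.
have [[Z z] _] := exact_additive ex.
exists (Conflation (conf_0idm ex (cf1 s) z)).
have bp := is_biproduct_shear (- cfi s) (bpP S).
rewrite compNm opprK in bp.
have aP : @commuting _ _ (Conflation (conf_0idm ex (cf1 s) z)) (split_conflation S)
    (0, inl S + inr S \oc - cfi s, - cfi s).
  rewrite /commuting /= !compm0 eqxx /=; apply/eqP.
  have [_ e1 _ e2 _] := biproductE S.
  by rewrite compm1 compDr compA e1 e2 comp1m add0r.
exists (CHom aP); split; first exact: split_right.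
split=> /=; first exact: conf_0idm.
  have -> : ch2 split_cover = prr S + cfi s \oc prl S by rewrite /ch2 /= /copair comp1m addrC.
  exact: (conf_biproduct ex bp).
rewrite /ch3 /=.
by apply: (exact_isoclosed ex (cfP s) (a := idm _) (b := - idm _) (d := - idm _));
  rewrite ?compmN ?compNm ?comp1m ?compm1 //; try exact: is_iso_idm;
  exists (- idm _); rewrite compNm compmN opprK comp1m.
Qed.

End Precover.

(** [(i, (1, p), 1)] maps [A -> B -> D] to [B -> B + D -> D], with cokernel
    [D -> D -> 0]. *)
Section Preenvelope.
Variables (s : CC) (S : biproduct (cf2 s) (cf3 s)).

Lemma split_hull_proof : @commuting _ _ s (split_conflation S)
  (cfi s, pairing S (idm _) (cfp s), idm _).
Proof.
rewrite /commuting /= prr_pair comp1m eqxx andbT; apply/eqP.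
by rewrite /pairing compDl -!compA cfp_cfi !compm0 addr0 comp1m.
Qed.

Definition split_hull : hom s (split_conflation S) := CHom split_hull_proof.

Lemma null_split_hull (t : CC) (u : hom s t) :
  null u -> exists v : hom (split_conflation S) t, u = v \oc split_hull.
Proof.
move=> [h hE].
have [|k kE] := conf_lift ex (cfP t) (t := ch2 u - h \oc cfp s).
  by rewrite compDr compmN compA -hE (chom_comm u).2 subrr.
have [|v [v2 v3]] := @chom_of_right_square (split_conflation S) t
    (copair S (cfi t \oc k) h) (ch3 u).
  apply: (copairP (S := S)); rewrite -!compA ?copair_inl ?copair_inr.
    have [_ _ _ -> _] := biproductE S.
    by rewrite compA cfp_cfi comp0m compm0.
  by have [_ -> _ _ _] := biproductE S; rewrite compm1 hE.
have v2u : ch2 u = ch2 (v \oc split_hull).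
  rewrite -[RHS]/(ch2 v \oc pairing S (idm _) (cfp s)) v2.
  by rewrite (copair_pair S) kE compm1 addrNK.
exists v; apply: chom_eq => //.
  apply: (conf_mono ex (cfP t)).
  by rewrite -(chom_comm u).1 -(chom_comm (v \oc split_hull)).1 -/(ch2 u) v2u.
by rewrite -[RHS]/(ch3 v \oc idm _) v3 compm1.
Qed.

Lemma split_hull_conflation : exists (r : CC) (a : hom (split_conflation S) r),
  split r /\ degreewise conf split_hull a.
Proof.
have [[Z z] _] := exact_additive ex.
exists (Conflation (conf_idm ex (cf3 s) z)).
have bp := is_biproduct_shear (cfp s) (bpP S).
have aP : @commuting _ _ (split_conflation S) (Conflation (conf_idm ex (cf3 s) z))
    (cfp s, cfp s \oc prl S - prr S, 0).
  rewrite /commuting /= !comp0m eqxx andbT; apply/eqP.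
  have [e1 _ _ e2 _] := biproductE S.
  by rewrite compDl compNm -compA e1 e2 subr0 compm1 comp1m.
exists (CHom aP); split; first exact: split_left.
split=> /=; first exact: cfP; last exact: conf_idm.
have := conf_biproduct ex bp.
rewrite /ch2 /= /pairing compm1 => c.
apply: (exact_isoclosed ex c (a := idm _) (b := idm _) (d := - idm _)).
- exact: is_iso_idm.
- exact: is_iso_idm.
- by exists (- idm _); rewrite compNm compmN opprK comp1m.
- by rewrite comp1m compm1.
- by rewrite compNm comp1m compm1 opprB.
Qed.

End Preenvelope.

Lemma null_from_split (s t : CC) (u : hom s t) : split s -> null u.
Proof.
by case/splitP=> q qE; exists (ch2 u \oc q); rewrite compA -(chom_comm u).2 -compA qE compm1.
Qed.

Lemma null_to_split (s t : CC) (u : hom s t) : split t -> null u.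
Proof.
by case/splitP=> q qE; exists (q \oc ch3 u); rewrite compA qE comp1m.
Qed.


(** Split conflations are closed under retracts, and a coproduct of split
    conflations is a retract of its split cover, since its injections factor
    through that cover. *)
Lemma add_split (s : CC) : split s <-> add split s.
Proof.
have [[Z z] aM] := exact_additive ex.
set O : CC := Conflation (conf_idm ex Z z).
have zs : idm O = 0 by apply: chom_eq; apply: (z Z).1.
split=> [ss|[s' [S [k [Y [U [j [Ys jU] [w [v [vw wv]]]]]]]]]].
  have bp : @is_biproduct CC s O s (idm s) 0 (idm s) 0.
    by split; rewrite ?comp1m ?compm0 ?comp0m ?addr0 // zs.
  exists O, (Biproduct bp), 1%N, (fun=> s), s, (fun=> idm s); split=> //; last first.
    by exists (idm s); apply: is_iso_idm.
  move=> T f; exists (f ord0); split=> [i|g gE]; first by rewrite compm1 ord1.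
  by rewrite -(gE ord0) compm1.
have [S'] := aM (cf1 U) (cf2 U).
have sU : split U.
  have fac i : exists g, j i = split_cover S' \oc g.
    exact/null_split_cover/null_from_split/Ys.
  have [c [cE _]] := jU _ (fun i => projT1 (boolp.cid (fac i))).
  apply: (split_retract (u := c) (v := split_cover S')); last exact: split_split_conflation.
  have [d [_ dU]] := jU _ j.
  rewrite -(dU (idm U)) => [|i]; last exact: comp1m.
  apply/esym/dU => i; rewrite -compA cE.
  by case: boolp.cid => g /= <-.
have [e1 _ _ _ _] := biproductE S.
apply: (split_retract (u := w \oc inl S) (v := prl S \oc v)) sU.
by rewrite -compA (compA v w) vw comp1m e1.
Qed.

Lemma split_pseudo_cluster_tilting : pseudo_cluster_tilting (degreewise conf) split.
Proof.
split=> [s|s]; first exact: add_split.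
have [_ aM] := exact_additive ex.
split.
  have [S] := aM (cf2 s) (cf3 s); have [r [a [rs c]]] := split_hull_conflation S.
  exists (split_conflation S), r, (split_hull S), a.
  have ss := split_split_conflation S; do 2!split=> //.
  by move=> t f ts; apply/null_split_hull/null_to_split.
have [S] := aM (cf1 s) (cf2 s); have [r [a [rs c]]] := split_cover_conflation S.
exists (split_conflation S), r, a, (split_cover S).
have ss := split_split_conflation S; do 2!split=> //.
by move=> t f ts; apply/null_split_cover/null_from_split.
Qed.


(** * The quotient by split conflations is abelian *)

Notation I := (factor_ideal split).
Notation Q := (quot_cat I).

Lemma null_ideal (s t : CC) (u : hom s t) : imem I u <-> null u.
Proof.
split=> [[r [rX ->]]|nu].
  elim: r rX => [_|g r IH rX]; first by exists 0; rewrite big_nil compm0.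
  rewrite big_cons.
  have [|h hE] := IH; first by move=> v vr; apply: rX; rewrite inE vr orbT.
  have [|Y [v [w [Ys ->]]]] := rX g; first by rewrite inE eqxx.
  have [k kE] := null_to_split v Ys.
  exists (ch2 w \oc k + h).
  by rewrite compDr -hE compA -(chom_comm w).2 -compA -kE.
have [_ aM] := exact_additive ex; have [S] := aM (cf1 t) (cf2 t).
have [v ->] := (null_split_cover S u).1 nu.
apply: (@imem_pre _ I); exists [:: split_cover S]; rewrite big_seq1; split=> // g.
rewrite inE => /eqP->; exists (split_conflation S), (idm _), (split_cover S).
by rewrite compm1; split=> //; apply: split_split_conflation.
Qed.

Definition qc (s t : CC) (u : hom s t) : @hom Q s t := cls I u.

Lemma qcP (s t : CC) (q : @hom Q s t) : exists u, q = qc u.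
Proof. by exists (generic_quotient.repr q); rewrite /qc cls_repr. Qed.

Lemma qcM (r s t : CC) (v : hom s t) (u : hom r s) : qc v \oc qc u = qc (v \oc u).
Proof. exact: qcomp_cls. Qed.

Lemma qcD (s t : CC) (u v : hom s t) : qc (u + v) = qc u + qc v.
Proof. exact: clsD. Qed.

Lemma qc_eq (s t : CC) (u v : hom s t) : qc u = qc v <-> null (u - v).
Proof. by rewrite -null_ideal; apply: cls_eqP. Qed.

Lemma qc0 (s t : CC) : qc (0 : hom s t) = 0.
Proof. by apply: (@addrI _ (qc 0)); rewrite -qcD !addr0. Qed.

Lemma qc_eq0 (s t : CC) (u : hom s t) : qc u = 0 <-> null u.
Proof. by rewrite -qc0 qc_eq subr0. Qed.

Lemma quot_additive : is_additive Q.
Proof.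
have [[Z z] aM] := exact_additive ex; split.
  exists (Conflation (conf_idm ex Z z) : CC).
  by apply: is_zeroP; apply/qc_eq0/null_to_split/split_left.
move=> s t; have [S1] := aM (cf1 s) (cf1 t); have [S2] := aM (cf2 s) (cf2 t).
have [S3] := aM (cf3 s) (cf3 t).
pose S : CC := Conflation (dsum_conf ex S1 S2 S3 (cfP s) (cfP t)).
have il : @commuting _ _ s S (inl S1, inl S2, inl S3).
  by rewrite /commuting /= !dsum_inl !eqxx.
have ir : @commuting _ _ t S (inr S1, inr S2, inr S3).
  by rewrite /commuting /= !dsum_inr !eqxx.
have pl : @commuting _ _ S s (prl S1, prl S2, prl S3).
  by rewrite /commuting /= !prl_dsum !eqxx.
have pr : @commuting _ _ S t (prr S1, prr S2, prr S3).
  by rewrite /commuting /= !prr_dsum !eqxx.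
have [a1 b1 c1 d1 e1] := biproductE S1; have [a2 b2 c2 d2 e2] := biproductE S2.
have [a3 b3 c3 d3 e3] := biproductE S3.
have bp : is_biproduct (qc (CHom il)) (qc (CHom ir)) (qc (CHom pl)) (qc (CHom pr)).
  by split; rewrite ?qcM -?qcD -?qc0; congr qc; apply: chom_eq.
by constructor; apply: (Biproduct bp).
Qed.

Section KernelCokernel.
Variables (E F : CC) (f : hom E F).

(** The kernel of [f] is represented by a conflation ending in
    [E2 + F1 -> G], with [G] the pullback of [F2 -> F3] along [f3]: a morphism
    from [T] into [E] is killed by [f] iff its last component lifts to [G]. *)
Lemma kernel_conflation : exists (K : CC) (k : hom K E) (phi : hom (cf3 K) (cf2 F)),
  [/\ cfp F \oc phi = ch3 f \oc ch3 k,
      forall T (u : hom T (cf2 F)) (v : hom T (cf3 E)), cfp F \oc u = ch3 f \oc v ->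
        exists w, phi \oc w = u /\ ch3 k \oc w = v &
      forall T (a : hom T (cf2 E)) (b : hom T (cf3 K)), cfp E \oc a = ch3 k \oc b ->
        exists w, cfp K \oc w = b].
Proof.
have [G [j [g [h [cG hj sq pb]]]]] := pullback_conflation ex (cfP F) (ch3 f).
have [w [wh wg]] := pb _ (ch2 f) (cfp E) (esym (chom_comm f).2).
have [_ aM] := exact_additive ex; have [S] := aM (cf2 E) (cf1 F).
have gj := conf0 ex cG.
have gd : g \oc copair S w j = cfp E \oc prl S.
  apply: (copairP (S := S)); rewrite -!compA ?copair_inl ?copair_inr ?wg ?gj.
    by have [-> _ _ _ _] := biproductE S; rewrite compm1.
  by have [_ _ -> _ _] := biproductE S; rewrite compm0.
have lift T (u : hom T (cf2 E)) (v : hom T G) : cfp E \oc u = g \oc v ->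
    exists t, prl S \oc t = u /\ copair S w j \oc t = v.
  move=> e; have [|t tE] := conf_lift ex cG (t := v - w \oc u).
    by rewrite compDr compmN compA wg e subrr.
  exists (pairing S u t); rewrite prl_pair copair_pair tE; split=> //.
  by rewrite addrC addrNK.
have prS T (t : hom T S) : copair S w j \oc t = w \oc (prl S \oc t) + j \oc (prr S \oc t).
  by rewrite compDl -!compA.
have [|m mE] := conf_lift ex cG (t := w \oc cfi E); first by rewrite compA wg cfp_cfi.
have c : conf (pairing S (cfi E) (- m)) (copair S w j).
  apply: (pullback_conf ex (p := cfp E) (f := g) (f' := prl S)) => //.
  - by exists (cf1 E), (cfi E); apply: cfP.
  - move=> T u v e1; rewrite !prS e1 => /addrI/(conf_mono ex cG).
    exact: pairP.
  - by rewrite copair_pair compmN mE subrr.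
  - move=> T t t0; have [|v vE] := conf_lift ex (cfP E) (t := prl S \oc t).
      by rewrite compA -gd -compA t0 compm0.
    exists v; apply: pairP; rewrite compA ?prl_pair ?prr_pair //.
    apply: (conf_mono ex cG).
    move: t0; rewrite prS -vE !compA -mE => /eqP; rewrite addrC addr_eq0 => /eqP->.
    by rewrite compmN compNm.
  - move=> T u v /(congr1 (fun t => prl S \oc t)); rewrite !compA prl_pair.
    exact: (conf_mono ex (cfP E)).
pose K : CC := Conflation c.
have [k [_ k3]] := @chom_of_right_square K E (prl S) g gd.
exists K, k, h; split=> //; rewrite k3 //.
by move=> T a b /lift[t [_ tE]]; exists t.
Qed.

(** The cokernel of [f] is represented by a conflation ending in
    [F2 + E3 -> F3], so that a morphism into [F] dies in it iff its last component
    is a sum of maps through [F2] and [E3]. *)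
Lemma cokernel_conflation : exists (K : CC) (q : hom F K),
  [/\ null (q \oc f),
      forall T (t : hom F T), null (t \oc f) -> exists v : hom K T, null (v \oc q - t),
      forall T (v : hom K T), null (v \oc q) -> null v &
      forall T (t : hom T F), null (q \oc t) -> exists u v,
        ch3 t = cfp F \oc u + ch3 f \oc v].
Proof.
have [_ aM] := exact_additive ex; have [S] := aM (cf2 F) (cf3 E).
have [N [n c]] := copair_deflation ex (cfP F) (ch3 f) S.
pose K : CC := Conflation c.
have [|q [_ q3]] := @chom_of_right_square F K (inl S) (idm _).
  by rewrite /= copair_inl comp1m.
exists K, q; split.
- exists (inr S); rewrite -[LHS]/(ch3 q \oc ch3 f) q3 comp1m.
  by rewrite /= copair_inr.
- move=> T t [h hE].
  have [|v [_ v3]] := @chom_of_right_square K T (copair S (ch2 t) h) (ch3 t).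
    apply: (copairP (S := S)); rewrite -!compA !(copair_inl, copair_inr).
      exact: (chom_comm t).2.
    by rewrite -hE.
  exists v, 0; rewrite ch3B -[ch3 (v \oc q)]/(ch3 v \oc ch3 q) q3 v3.
  by rewrite compm1 subrr compm0.
- move=> T v [h]; rewrite -[ch3 (v \oc q)]/(ch3 v \oc ch3 q) q3 compm1 => hE.
  by exists h.
- move=> T t [h]; rewrite -[ch3 (q \oc t)]/(ch3 q \oc ch3 t) q3 comp1m => ->.
  exists (prl S \oc h), (prr S \oc h).
  by rewrite /= compDl -!compA.
Qed.

End KernelCokernel.

Lemma qcM0 (r s t : CC) (v : hom s t) (u : hom r s) :
  qc v \oc qc u = 0 <-> null (v \oc u).
Proof. by rewrite qcM qc_eq0. Qed.

Lemma null_ch3B0 (s t : CC) (u v : hom s t) : ch3 u = ch3 v -> qc u = qc v.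
Proof. by move=> e; apply/qc_eq; exists 0; rewrite ch3B e subrr compm0. Qed.

Lemma quot_split_abelian : is_abelian Q.
Proof.
split; first exact: quot_additive.
- move=> E F q; have [f ->] := qcP q.
  have [K [k [phi [sq pb lift]]]] := kernel_conflation f.
  exists K, (qc k); apply: kernel_of_mono.
  + by apply/qcM0; exists phi; rewrite sq.
  + move=> T r; have [t ->] := qcP r; move/qcM0=> [u uE].
    have [w [wu wt]] := pb _ _ _ (esym uE).
    have [|w2 w2E] := lift _ (ch2 t) (w \oc cfp T).
      by rewrite compA wt (chom_comm t).2.
    have [|v [_ v3]] := @chom_of_right_square T K w2 w; first by rewrite w2E.
    by exists (qc v); rewrite qcM; apply: null_ch3B0; rewrite ch3M v3 wt.
  + move=> T r; have [t ->] := qcP r; move/qcM0=> [u uE].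
    have [w wE] := lift _ u (ch3 t) (esym uE).
    by apply/qc_eq0; exists w; rewrite wE.
- move=> E F q; have [f ->] := qcP q.
  have [K [c [cf desc cepi _]]] := cokernel_conflation f.
  exists K, (qc c); apply: cokernel_of_epi; first exact/qcM0.
  + move=> T r; have [t ->] := qcP r; move/qcM0=> /desc[v vE].
    by exists (qc v); rewrite qcM; apply/qc_eq.
  + by move=> T r; have [t ->] := qcP r; move/qcM0=> /cepi/qc_eq0.
- move=> E F q; have [f ->] := qcP q => fm.
  have [K [k [phi [sq pb lift]]]] := kernel_conflation f.
  have [L [c [cf _ _ cker]]] := cokernel_conflation f.
  (* [f] is mono, so its kernel vanishes: [G -> E3] lifts to [E2] *)
  have [h hE] : null k.
    by apply/qc_eq0/fm; rewrite compm0; apply/qcM0; exists phi; rewrite sq.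
  exists L, (qc c); apply: kernel_of_mono; first exact/qcM0.
  + move=> T r; have [t ->] := qcP r; move/qcM0=> /cker[u [v tE]].
    have [|w [wu wv]] := pb _ (ch2 t - u \oc cfp T) (v \oc cfp T).
      by rewrite compDr compmN -(chom_comm t).2 -/(ch3 t) tE compDl -!compA addrC addrA addNr add0r.
    have [|m [_ m3]] := @chom_of_right_square T E (h \oc w) v.
      by rewrite compA -hE wv.
    exists (qc m); rewrite qcM; apply/qc_eq; exists (- u).
    by rewrite ch3B ch3M m3 tE compmN opprD addrCA subrr addr0.
  + move=> T r; have [t ->] := qcP r => ft; apply: fm.
    by rewrite ft compm0.
- move=> E F q; have [f ->] := qcP q => fe.
  have [K [k [phi [sq pb lift]]]] := kernel_conflation f.
  have [L [c [cf _ _ cker]]] := cokernel_conflation f.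
  (* [f] is epi, so its cokernel vanishes and [F2 + E3 -> F3] splits *)
  have [|u [v uv]] := cker F (@idm CC F).
    by rewrite compm1; apply/qc_eq0/fe; rewrite comp0m; apply/qcM0.
  have {}uv : idm (cf3 F) = cfp F \oc u + ch3 f \oc v := uv.
  exists K, (qc k); apply: cokernel_of_epi.
  + by apply/qcM0; exists phi; rewrite sq.
  + move=> T r; have [t ->] := qcP r; move/qcM0=> [h hE].
    have [|w [_ wk]] := pb _ (idm _ - u \oc cfp F) (v \oc cfp F).
      by rewrite compDr compmN compm1 !compA -[X in X - _]comp1m uv compDl addrAC subrr add0r.
    have [|m [_ m3]] := @chom_of_right_square F T (h \oc w) (ch3 t \oc v).
      by rewrite compA -hE ch3M -!compA wk.
    exists (qc m); rewrite qcM; apply/qc_eq.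
    have [|w' [_ wk']] := pb _ (- (u \oc ch3 f)) (v \oc ch3 f - idm _).
      rewrite compDr !compmN compm1 -[X in _ = _ - X]comp1m uv compDl !compA opprD.
      by rewrite addrCA subrr addr0.
    exists (h \oc w').
    by rewrite ch3B ch3M m3 compA -hE ch3M -!compA wk' compDr compmN compm1.
  + move=> T r; have [t ->] := qcP r => tf; apply: fe.
    by rewrite tf comp0m.
Qed.

End ConflationCategory.

Lemma pseudo_cluster_tilting_resolutions (C : precat) (conf : conf_class C) (D : C -> Prop)
    (s : C) : pseudo_cluster_tilting conf D -> wedge conf D 1 s /\ vee conf D 1 s.
Proof.
case=> _ /(_ s) [[D0 [D1 [a [b [D0D D1D c _]]]]] [E0 [E1 [d [e [E0D E1D c' _]]]]]].
have iso (A : C) : isomorphic A A by exists (idm A); apply: is_iso_idm.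
split; exists 1%N => //.
  by apply: (ResolutionS E0D c'); apply: (Resolution0 conf E1D).
by apply: (CoresolutionS D0D c); apply: (Coresolution0 conf D1D).
Qed.

(** * Exact sequences of an extriangulated category *)

Section Extriangulated.
Variable C : extriangulated.
Notation E := (extE C).

Lemma pull0 (D D' A : C) (u : E D A) : pull E (0 : hom D' D) u = 0.
Proof. by apply: (@addrI _ (pull E 0 u)); rewrite -pullD !addr0. Qed.

Lemma push0 (D A A' : C) (u : E D A) : push E (0 : hom A A') u = 0.
Proof. by apply: (@addrI _ (push E 0 u)); rewrite -pushD !addr0. Qed.

Lemma pullN (D D' A : C) (c : hom D' D) (u : E D A) : pull E (- c) u = - pull E c u.
Proof. by apply: (@addrI _ (pull E c u)); rewrite -pullD !subrr pull0. Qed.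

Lemma pushN (D A A' : C) (a : hom A A') (u : E D A) : push E (- a) u = - push E a u.
Proof. by apply: (@addrI _ (push E a u)); rewrite -pushD !subrr push0. Qed.

Lemma pullB (D D' A : C) (c c' : hom D' D) (u : E D A) :
  pull E (c - c') u = pull E c u - pull E c' u.
Proof. by rewrite pullD pullN. Qed.

Lemma pushB (D A A' : C) (a a' : hom A A') (u : E D A) :
  push E (a - a') u = push E a u - push E a' u.
Proof. by rewrite pushD pushN. Qed.

Lemma zero_biproductP (A Z : C) :
  is_zero Z -> is_biproduct (idm A) (0 : hom Z A) (idm A) (0 : hom A Z).
Proof.
move=> z; split; rewrite ?comp1m ?compm1 ?compm0 ?comp0m ?addr0 //.
exact: (z Z).1.
Qed.

Definition zero_biproduct (A Z : C) (z : is_zero Z) : biproduct A Z :=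
  Biproduct (zero_biproductP A z).

Lemma realizes_idm0 (A Z : C) : is_zero Z ->
  realizes C (0 : E Z A) (idm A) (0 : hom A Z).
Proof. by move=> z; apply: (realizes_zeroP (zero_biproduct A z)). Qed.

Lemma realizes_0idm (A Z : C) : is_zero Z ->
  realizes C (0 : E A Z) (0 : hom Z A) (idm A).
Proof. by move=> z; apply: (realizes_zeroP (biproduct_sym (zero_biproduct A z))). Qed.

Lemma has_zero : exists Z : C, is_zero Z.
Proof. by have [] := ecat_additive C. Qed.

Lemma has_biproduct (A B : C) : exists S : biproduct A B, True.
Proof. by have [_ /(_ A B)[S]] := ecat_additive C; exists S. Qed.

Section OneTriangle.
Variables (A B D : C) (d : E D A) (x : hom A B) (y : hom B D) (r : realizes C d x y).

Lemma tri_comp0 : y \oc x = 0.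
Proof.
have [Z z] := has_zero.
have [//|c [_ e]] := et3 (realizes_idm0 A z) r (a := idm A) (b := x).
by rewrite -e compm0.
Qed.

Lemma tri_push0 : push E x d = 0.
Proof.
have [Z z] := has_zero.
have [//|c [e _]] := et3 r (realizes_idm0 B z) (a := x) (b := idm B).
by rewrite e raddf0.
Qed.

Lemma tri_pull0 : pull E y d = 0.
Proof.
have [Z z] := has_zero.
have [//|a [e _]] := et3op (realizes_0idm B z) r (b := idm B) (c := y).
by rewrite -e raddf0.
Qed.

Lemma tri_lift_ext T (t : hom T D) : pull E t d = 0 -> exists u, y \oc u = t.
Proof.
move=> td; have [Z z] := has_zero.
have [|b [_ e]] := realizes_morphP (realizes_0idm T z) r (a := 0) (c := t).
  by rewrite /ext_morph raddf0 td.
by exists b; rewrite -e compm1.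
Qed.

Lemma tri_desc T (t : hom B T) : t \oc x = 0 -> exists u, u \oc y = t.
Proof.
move=> tx; have [Z z] := has_zero.
have [|c [_ e]] := et3 r (realizes_0idm T z) (a := 0) (b := t).
  by rewrite compm0 tx.
by exists c; rewrite e comp1m.
Qed.

Lemma tri_desc_ext T (t : hom A T) : push E t d = 0 -> exists u, u \oc x = t.
Proof.
move=> td; have [Z z] := has_zero.
have [|b [e _]] := realizes_morphP r (realizes_idm0 T z) (a := t) (c := 0).
  by rewrite /ext_morph raddf0 td.
by exists b; rewrite e comp1m.
Qed.

(** An extension killed by [x] is realized by a sequence through which [x]
    factors, so (ET3) compares it with the triangle. *)
Lemma tri_ker_push T (z : E T A) : push E x z = 0 -> exists t, z = pull E t d.
Proof.
move=> xz; have [B' [x' [y' [r' _]]]] := realizes_class z.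
have [Z zZ] := has_zero.
have [|b [e _]] := realizes_morphP r' (realizes_idm0 B zZ) (a := x) (c := 0).
  by rewrite /ext_morph raddf0 xz.
have [|c [e' _]] := et3 r' r (a := idm A) (b := b); first by rewrite e comp1m compm1.
by exists c; rewrite -e' push_id.
Qed.

Lemma tri_ker_pull T (z : E D T) : pull E y z = 0 -> exists t, z = push E t d.
Proof.
move=> yz; have [B' [x' [y' [r' _]]]] := realizes_class z.
have [Z zZ] := has_zero.
have [|b [_ e]] := realizes_morphP (realizes_0idm B zZ) r' (a := 0) (c := y).
  by rewrite /ext_morph raddf0 yz.
have [|a [e' _]] := et3op r r' (b := b) (c := idm D); first by rewrite -e comp1m compm1.
by exists a; rewrite e' pull_id.
Qed.

Lemma tri_iso_middle B' (b : hom B B') (b' : hom B' B) :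
  b' \oc b = idm B -> b \oc b' = idm B' -> realizes C d (b \oc x) (y \oc b').
Proof.
move=> e1 e2; have [B0 [x0 [y0 [r0 eqv]]]] := realizes_class d.
have [c [[c' [c1 c2]] cx yc]] := (eqv _ _ _).1 r.
apply/eqv; exists (b \oc c); split.
- by exists (c' \oc b'); rewrite -!compA (comp_assoc e1) (comp_assoc c2) !comp1m.
- by rewrite -compA cx.
- by rewrite -compA (comp_assoc e1) comp1m.
Qed.

Lemma tri_split (S : biproduct A D) : d = 0 -> isomorphic B S.
Proof.
move=> d0; have [B0 [x0 [y0 [_ eqv]]]] := realizes_class d.
have [b [[b' [b1 b2]] _ _]] := (eqv _ _ _).1 r.
have [|c [[c' [c1 c2]] _ _]] := (eqv _ (inl S) (prr S)).1.
  by rewrite d0; apply: realizes_zeroP.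
exists (c \oc b'), (b \oc c'); split.
  by rewrite -compA (comp_assoc c1) comp1m b2.
by rewrite -compA (comp_assoc b1) comp1m c2.
Qed.

End OneTriangle.

Lemma square_zero_iso (A : C) (e : hom A A) :
  (e - idm A) \oc (e - idm A) = 0 -> is_iso e.
Proof.
set n := e - idm A => n0; have -> : e = idm A + n by rewrite addrC addrNK.
move: (n) n0 => {e}n n0; exists (idm A - n).
by rewrite !compDl !compDr !compmN !compNm !comp1m !compm1 n0 oppr0 !addr0 subrK addrK.
Qed.

Lemma iso_of_composites (A B : C) (f : hom A B) (g : hom B A) :
  is_iso (g \oc f) -> is_iso (f \oc g) -> is_iso f.
Proof.
move=> [u [u1 u2]] [v [v1 v2]]; exists (u \oc g); split; first by rewrite -compA.
have e : u \oc g = g \oc v.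
  by rewrite -[LHS]compm1 -v2 !compA -(compA u) u1 comp1m.
by rewrite e compA.
Qed.

(** Two cones of the same inflation are isomorphic: the comparison maps given
    by (ET3) are inverse to each other up to square-zero endomorphisms. *)
Lemma tri_cone_unique (A B D D' : C) (d : E D A) (d' : E D' A) (x : hom A B)
    (y : hom B D) (y' : hom B D') :
  realizes C d x y -> realizes C d' x y' ->
  exists c : hom D D', is_iso c /\ c \oc y = y'.
Proof.
move=> r r'; have e : idm B \oc x = x \oc idm A by rewrite comp1m compm1.
have [c [c1 c2]] := et3 r r' e; have [c' [c1' c2']] := et3 r' r e.
rewrite /ext_morph push_id in c1; rewrite compm1 in c2.
rewrite /ext_morph push_id in c1'; rewrite compm1 in c2'.
exists c; split=> //.
have iso (D1 : C) (d1 : E D1 A) (y1 : hom B D1) (r1 : realizes C d1 x y1) (h : hom D1 D1) :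
    h \oc y1 = y1 -> pull E h d1 = d1 -> is_iso h.
  move=> hy hd; apply: square_zero_iso.
  have [|s sE] := tri_lift_ext r1 (t := h - idm D1).
    by rewrite pullB hd pull_id subrr.
  by rewrite -{2}sE compA compDl compNm comp1m hy subrr comp0m.
apply: (iso_of_composites (g := c')).
  by apply: (iso _ _ _ r); [rewrite -compA c2 c2' | rewrite pull_comp -c1' -c1].
by apply: (iso _ _ _ r'); [rewrite -compA c2' c2 | rewrite pull_comp -c1 -c1'].
Qed.

(** The given sequence is compared with a realization of the transported class;
    as for cones, the comparison map is invertible up to square-zero
    endomorphisms. *)
Lemma tri_iso_left (A A' B D : C) (d : E D A) (x : hom A B) (y : hom B D)
    (a : hom A' A) (a' : hom A A') :
  a \oc a' = idm A -> a' \oc a = idm A' -> realizes C d x y ->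
  realizes C (push E a' d) (x \oc a) y.
Proof.
move=> e1 e2 r; have [B' [x' [y' [r' _]]]] := realizes_class (push E a' d).
have [|b [bx yb]] := realizes_morphP r r' (a := a') (c := idm D).
  by rewrite /ext_morph pull_id.
have [|b' [bx' yb']] := realizes_morphP r' r (a := a) (c := idm D).
  by rewrite /ext_morph pull_id -push_comp e1 push_id.
rewrite !comp1m in yb yb'.
have iso (A1 B1 : C) (d1 : E D A1) (x1 : hom A1 B1) (y1 : hom B1 D)
    (r1 : realizes C d1 x1 y1) (h : hom B1 B1) :
    h \oc x1 = x1 -> y1 \oc h = y1 -> is_iso h.
  move=> hx hy; apply: square_zero_iso.
  have [|s sE] := tri_desc r1 (t := h - idm B1).
    by rewrite compDl compNm comp1m hx subrr.
  by rewrite -{1}sE -compA compDr compmN compm1 hy subrr compm0.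
have [||b1 [b11 b12]] := iso_of_composites (f := b) (g := b').
- apply: (iso _ _ _ _ _ r); last by rewrite compA -yb' yb.
  by rewrite -compA bx compA bx' -compA e1 compm1.
- apply: (iso _ _ _ _ _ r'); last by rewrite compA -yb yb'.
  by rewrite -compA bx' compA bx -compA e2 compm1.
have -> : x \oc a = b1 \oc x'.
  by rewrite -[x]comp1m -b11 -2!compA (compA b) bx -compA e2 compm1.
rewrite yb; exact: (tri_iso_middle r' b12 b11).
Qed.

Lemma tri_sum_idm (A B D A' : C) (d : E D A) (x : hom A B) (y : hom B D)
    (T : biproduct A A') (S : biproduct B A') : realizes C d x y ->
  realizes C (push E (inl T) d) (dsum T S x (idm A')) (y \oc prl S).
Proof.
move=> r; have [Z z] := has_zero.
have := realizes_sumsP T S (zero_biproduct D z) r (realizes_idm0 A' z).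
rewrite /ext_dsum !raddf0 addr0 pull_id /dsum.
by rewrite comp1m !comp0m addr0.
Qed.

(** Pushing a triangle out along [f]: (ET4) for the split inflation
    [(1, -f) : A -> A + A'] followed by [x + 1 : A + A' -> B + A'] produces the
    pushout together with the conflation [A -> B + A' -> H] of its square. *)
Lemma tri_pushout (A B D A' : C) (d : E D A) (x : hom A B) (y : hom B D)
    (f : hom A A') (S : biproduct B A') : realizes C d x y ->
  exists (H : C) (h : hom S H) (e : hom H D),
    [/\ realizes C (push E f d) (h \oc inr S) e,
        realizes C (pull E e d) (pairing S x (- f)) h & e \oc h = y \oc prl S].
Proof.
move=> r; have [T _] := has_biproduct A A'.
have bp := is_biproduct_shear (- f) (bpP T).
have r1 := realizes_zeroP (Biproduct bp); have r2 := tri_sum_idm T S r.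
rewrite /= compNm opprK in r1.
have [H [h [k [e [d2 [[r3 kh eh] [r4 _ d2E]]]]]]] := et4 r1 r2.
have [t1 t2 t3 t4 _] := biproductE T.
have kE : k = h \oc inr S.
  rewrite -[inr S]compm1 -(dsum_inr T S x) compA -kh -compA compDl -compA t2 t3.
  by rewrite compm0 addr0 compm1.
exists H, h, e; split=> //.
- by move: r4; rewrite -push_comp compDl -compA t4 t1 compm1 add0r kE.
have -> : pairing S x (- f) = dsum T S x (idm A') \oc (inl T + inr T \oc - f).
  by rewrite compDr compA dsum_inl dsum_inr compm1.
suff -> : pull E e d = d2 by [].
move: (congr1 (push E (prl T)) d2E).
rewrite pull_push -!push_comp t1 push_id compDr compA t1 t3 comp0m addr0 push_id.
by move=> ->.
Qed.

(** Both triangles produce a cone of [(x, x') : A -> B + B'], up to a sign that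
    [tri_iso_left] absorbs, and cones are unique. *)
Lemma tri_double_pushout (A B D B' D' : C) (d : E D A) (d' : E D' A)
    (x : hom A B) (y : hom B D) (x' : hom A B') (y' : hom B' D') :
  realizes C d x y -> realizes C d' x' y' ->
  exists (H : C) (u : hom B H) (v : hom H D') (u' : hom B' H) (v' : hom H D),
    realizes C (push E x d') u v /\ realizes C (push E x' d) u' v'.
Proof.
move=> r r'; have [S _] := has_biproduct B B'.
have [H [h [e [r1 r2 _]]]] := tri_pushout x' S r.
have [H' [h' [e' [r1' r2' _]]]] := tri_pushout x (biproduct_sym S) r'.
have r3 : realizes C (push E (- idm A) (pull E e' d')) (pairing S x (- x')) h'.
  have -> : pairing S x (- x') = pairing (biproduct_sym S) x' (- x) \oc - idm A.
    by rewrite compmN compm1 /pairing /= !compmN opprD opprK addrC.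
  by apply: tri_iso_left r2'; rewrite compNm compmN comp1m opprK.
have [c [[c' [c1 c2]] _]] := tri_cone_unique r2 r3.
exists H, (c' \oc (h' \oc inl S)), (e' \oc c), (h \oc inr S), e; split=> //.
exact: (tri_iso_middle r1' c2 c1).
Qed.

(** [(y, f) : B + P -> D] is [y + 1] followed by a split deflation. *)
Lemma tri_copair_deflation (A B D P : C) (d : E D A) (x : hom A B) (y : hom B D)
    (f : hom P D) (S : biproduct B P) : realizes C d x y ->
  deflation (@econf C) (copair S y f).
Proof.
move=> r; have [U _] := has_biproduct D P; have [Z z] := has_zero.
have r1 := realizes_sumsP (zero_biproduct A z) S U r (realizes_0idm P z).
have bp := is_biproduct_shear (- f) (is_biproduct_sym (bpP U)).
have r2 := realizes_zeroP (Biproduct bp).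
have [H [h [k [e [d2 [[r3 _ _] _]]]]]] := et4op r1 r2.
exists H, h, d2; move: r3.
rewrite /= compNm opprK compDl -compA prl_dsum prr_dsum comp1m.
by [].
Qed.

End Extriangulated.

(** * Objects with a finite coresolution by a rigid class *)

Lemma isomorphic_sym (C : precat) (A B : C) : isomorphic A B -> isomorphic B A.
Proof. by case=> f [g [gf fg]]; exists g, f. Qed.

Section RigidClass.
Variables (C : extriangulated) (H : higher_ext C) (n : nat) (X : C -> Prop).
Hypothesis X_add : forall A : C, X A <-> add X A.
Hypothesis X_rigid : rigid H n X.
Notation E := (extE C).

Lemma coproduct1 (A B : C) (f : hom A B) : is_iso f ->
  is_coproduct (fun _ : 'I_1 => f).
Proof.
move=> [g [gf fg]] T t; exists (t ord0 \oc g); split=> [i|u uE].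
  by rewrite -compA gf compm1 ord1.
by rewrite -(uE ord0) -compA fg compm1.
Qed.

Lemma X_iso (A B : C) : X A -> isomorphic A B -> X B.
Proof.
move=> XA AB; have [Z z] := has_zero C; apply/X_add.
exists Z, (zero_biproduct B z), 1%N, (fun=> A), A, (fun=> idm A); split=> //.
- by apply: coproduct1; apply: is_iso_idm.
- exact: isomorphic_sym.
Qed.

Lemma X_zero (Z : C) : is_zero Z -> X Z.
Proof.
move=> z; apply/X_add; exists Z, (zero_biproduct Z z), 0%N, (fun=> Z), Z, (fun=> idm Z).
split=> [[]//||]; last by exists (idm Z); apply: is_iso_idm.
by move=> T f; exists 0; split=> [[]//|g _]; apply: (z T).2.
Qed.

Lemma X_summand (A B : C) (S : biproduct A B) : X S -> X A.
Proof.
move=> XS; apply/X_add; exists B, S, 1%N, (fun=> S : C), S, (fun=> idm S); split=> //.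
- by apply: coproduct1; apply: is_iso_idm.
- by exists (idm S); apply: is_iso_idm.
Qed.

Lemma X_sum (A B : C) (S : biproduct A B) : X A -> X B -> X S.
Proof.
move=> XA XB; have [Z z] := has_zero C; apply/X_add.
pose Y (i : 'I_2) := if val i is 0 then A else B.
pose j (i : 'I_2) : hom (Y i) S :=
  match val i as v return hom (if v is 0 then A else B) S with 0 => inl S | _ => inr S end.
exists Z, (zero_biproduct S z), 2, Y, S, j; split.
- by case=> [[|[|]]].
- move=> T f; exists (copair S (f ord0) (f ord_max)); split=> [[[|[|//]] i]|g gE].
  + by rewrite copair_inl (bool_irrelevance i (ltn0Sn 1)).
  + by rewrite copair_inr (bool_irrelevance i (ltnSn 1)).
  + by apply: copairP; rewrite ?copair_inl ?copair_inr -gE.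
- by exists (idm S); apply: is_iso_idm.
Qed.

(** [vee X m] with coresolutions of length exactly [m]; shorter ones are padded
    by [K -> K -> 0]. *)
Fixpoint cores (m : nat) (K : C) : Prop :=
  if m is m'.+1 then exists (Y K' : C) (x : hom K Y) (y : hom Y K'),
    [/\ X Y, cores m' K' & econf x y]
  else X K.

Lemma cores_coresolution (m : nat) (K : C) : cores m K <-> coresolution (@econf C) X m K.
Proof.
split.
  elim: m K => [|m IH] K; first by move=> XK; apply: (Coresolution0 _ XK); exists (idm K); apply: is_iso_idm.
  by move=> [Y [K' [x [y [XY /IH cK' xy]]]]]; apply: CoresolutionS cK'; eassumption.
elim=> {m K} [K Y XY KY|m K Y K' x y XY xy _ IH] /=.
  by apply: X_iso XY _; apply: isomorphic_sym.
by exists Y, K', x, y.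
Qed.

Lemma coresS (m : nat) (K : C) : cores m K -> cores m.+1 K.
Proof.
elim: m K => [|m IH] K; last first.
  by move=> [Y [K' [x [y [XY /IH cK' xy]]]]]; exists Y, K', x, y.
move=> XK; have [Z z] := has_zero C; exists K, Z, (idm K), 0; split=> //; first exact: X_zero.
by exists 0; apply: realizes_idm0.
Qed.

Lemma cores_le (m m' : nat) (K : C) : (m <= m')%N -> cores m K -> cores m' K.
Proof. by move=> /subnK <-; elim: (m' - m)%N => // k IH /IH/coresS. Qed.

Lemma vee_cores (m : nat) (K : C) : vee (@econf C) X m K <-> cores m K.
Proof.
split=> [[k km /cores_coresolution]|/cores_coresolution cK]; first exact: cores_le.
by exists m.
Qed.

(** Dimension shifting: each step of the coresolution uses up one degree of
    rigidity. *)
Lemma cores_ext0 (m : nat) (K Y : C) (u : E K Y) : (m <= n)%N -> cores m K -> X Y -> u = 0.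
Proof. by move=> mn /cores_coresolution cK XY; apply: (Ext_vee_X X_rigid cK (i := 0)). Qed.

Lemma cores_iso (m : nat) (A B : C) : cores m A -> isomorphic A B -> cores m B.
Proof.
case: m => [|m]; first exact: X_iso.
move=> [Y [K [x [y [XY cK [d r]]]]]] [f [g [gf fg]]].
exists Y, K, (x \oc g), y; split=> //; exists (push E f d).
exact: (tri_iso_left gf fg r).
Qed.

(** The horseshoe lemma. The map [A -> Y0] extends along [A -> G] because it
    kills the class of the extension, and the cosyzygies of [A] and [D] then
    form an extension of the same kind, whose condition is automatic since
    [E(D1, -)] vanishes on [X]. *)
Lemma cores_extension (m : nat) (A G D : C) (d : E D A) (x : hom A G) (y : hom G D) :
  (m <= n.+1)%N -> realizes C d x y -> cores m A -> cores m D ->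
  (forall Y (k : hom A Y), X Y -> push E k d = 0) -> cores m G.
Proof.
elim: m A G D d x y => [|m IH] A G D d x y mn r.
  move=> XA XD /(_ A (idm A) XA); rewrite push_id => d0.
  have [S _] := has_biproduct A D.
  by apply: X_iso (isomorphic_sym (tri_split r S d0)); apply: X_sum.
move=> [Y0 [A1 [al [p [XY0 cA1 [ka rk]]]]]] [Y1 [D1 [ga [q [XY1 cD1 [ep re]]]]]] dX.
have [W [u [v [u' [v' [r1 r2]]]]]] := tri_double_pushout r rk.
have [S _] := has_biproduct Y0 D; have [SB _] := has_biproduct Y0 Y1.
have [w [w' [w1 w2]]] := tri_split r2 S (dX _ _ XY0).
have [Z z] := has_zero C.
have r3 := realizes_sumsP S SB (biproduct_sym (zero_biproduct D1 z)) (realizes_idm0 Y0 z) re.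
have r4 := tri_iso_left w2 w1 r3.
have [K [h [k [e [d2 [[r5 _ _] [r6 _ _]]]]]]] := et4 r1 r4.
exists SB, K, (dsum S SB (idm Y0) ga \oc w \oc u), h; split; first exact: X_sum.
  apply: (IH _ _ _ _ _ _ (ltnW mn) r6 cA1 cD1) => Y t XY.
  exact: (cores_ext0 _ mn cD1 XY).
by exists d2.
Qed.

Lemma cores_sum (m : nat) (A B : C) (S : biproduct A B) : (m <= n.+1)%N ->
  cores m A -> cores m B -> cores m S.
Proof.
move=> mn cA cB; apply: (cores_extension mn (realizes_zeroP S) cA cB) => Y k _.
by rewrite raddf0.
Qed.

(** Schanuel: pushing the sum of two approximations out along a coresolution of
    the sum exhibits the cosyzygies of the summands as summands of an
    extension of [K1] by an object of [X]. *)
Lemma cores_summand (m : nat) (A B : C) (S : biproduct A B) : (m <= n.+1)%N ->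
  cores m S -> cores m A.
Proof.
elim: m A B S => [|m IH] A B S mn; first exact: X_summand.
move=> [Y0 [K1 [xi [q [XY0 cK1 [ka rk]]]]]].
have [L [l [_ [_ [dl [[rl _ _] _]]]]]] := et4 (realizes_zeroP S) rk.
have [L' [l' [_ [_ [dl' [[rl' _ _] _]]]]]] := et4 (realizes_zeroP (biproduct_sym S)) rk.
have [YY _] := has_biproduct Y0 Y0; have [LL _] := has_biproduct L L'.
have r := realizes_sumsP S YY LL rl rl'.
have [W [u [v [u' [v' [r1 r2]]]]]] := tri_double_pushout r rk.
have xiE : xi = copair YY (idm Y0) (idm Y0) \oc dsum S YY (xi \oc inl S) (xi \oc inr S).
  by apply: copairP; rewrite -compA (dsum_inl, dsum_inr) compA ?copair_inl ?copair_inr comp1m.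
have [SS _] := has_biproduct Y0 LL.
have iW := tri_split r2 SS; rewrite {1}xiE push_comp (tri_push0 r) raddf0 in iW.
exists Y0, L, (xi \oc inl S), l; split=> //; last by exists dl.
apply: (IH _ _ LL (ltnW mn)); apply: (IH _ _ (biproduct_sym SS) (ltnW mn)).
apply: cores_iso (iW erefl).
apply: (cores_extension (ltnW mn) r1) => //.
  by apply: (@cores_le 0) => //; apply: X_sum.
by move=> Y k XY; apply: (cores_ext0 _ mn cK1 XY).
Qed.

End RigidClass.

(** * The functor [F] is fully faithful *)

Section FunctorF.
Variables (C : extriangulated) (H : higher_ext C) (n : nat) (X : C -> Prop).
Hypothesis X_add : forall A : C, X A <-> add X A.
Hypothesis X_rigid : rigid H n X.
Notation E := (extE C).
Notation M1 := (M1 n X).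
Notation St := (Xvee_stable n X).

(** Typed so as to read morphisms between the underlying objects in [M1]. *)
Definition mc (A B : M1) (f : hom (sval A) (sval B)) : hom A B := cls (Xideal n X) f.

Lemma mcP (A B : M1) (q : hom A B) : exists f : hom (sval A) (sval B), q = mc f.
Proof. by exists (generic_quotient.repr q); rewrite /mc cls_repr. Qed.

Lemma mcM (A B D : M1) (g : hom (sval B) (sval D)) (f : hom (sval A) (sval B)) :
  mc g \oc mc f = mc (g \oc f).
Proof. exact: qcomp_cls. Qed.

Lemma mcD (A B : M1) (f g : hom (sval A) (sval B)) : mc (f + g) = mc f + mc g.
Proof. exact: clsD. Qed.

Lemma mc0 (A B : M1) : mc (0 : hom (sval A) (sval B)) = 0.
Proof. by apply: (@addrI _ (mc 0)); rewrite -mcD !addr0. Qed.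

Lemma F_mc (A B : M1) (f : hom (sval A) (sval B)) (K : St) (z : F_ob A K) :
  F_hom (mc f) K z = push E f z.
Proof. exact: (F_hom_cls X_rigid). Qed.

Lemma F_homM (A B D : M1) (g : hom B D) (f : hom A B) (K : St) (z : F_ob A K) :
  F_hom (g \oc f) K z = F_hom g K (F_hom f K z).
Proof.
have [g' ->] := mcP g; have [f' ->] := mcP f.
by rewrite mcM !F_mc push_comp.
Qed.

Lemma F_homD (A B : M1) (g f : hom A B) (K : St) (z : F_ob A K) :
  F_hom (g + f) K z = F_hom g K z + F_hom f K z.
Proof.
have [g' ->] := mcP g; have [f' ->] := mcP f.
by rewrite -mcD !F_mc pushD.
Qed.

Lemma F_hom1 (A : M1) (K : St) (z : F_ob A K) : F_hom (idm A) K z = z.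
Proof. by rewrite [LHS](F_mc (idm (sval A))) push_id. Qed.

Lemma F_hom0 (A B : M1) (K : St) (z : F_ob A K) : F_hom (0 : hom A B) K z = 0.
Proof. by rewrite -mc0 F_mc push0. Qed.

Lemma F_homN (A B : M1) (g : hom A B) (K : St) (z : F_ob A K) :
  F_hom (- g) K z = - F_hom g K z.
Proof. by apply: (@addrI _ (F_hom g K z)); rewrite -F_homD !subrr F_hom0. Qed.

Lemma F_hom_pull (A B : M1) (g : hom A B) (K K' : St) (c : hom (sval K') (sval K))
    (z : F_ob A K) :
  F_hom g K' (pull E c z) = pull E c (F_hom g K z : E (sval K) (sval B)).
Proof. by have [g' ->] := mcP g; rewrite !F_mc pull_push. Qed.

Lemma M1_cores (A : M1) : cores X n.+1 (sval A).
Proof. exact/(vee_cores X_add)/(svalP A). Qed.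

Lemma St_cores (A : St) : cores X n (sval A).
Proof. exact/(vee_cores X_add)/(svalP A). Qed.

Lemma St_ext0 (K : St) (Y : C) (u : E (sval K) Y) : X Y -> u = 0.
Proof. exact/(cores_ext0 X_add X_rigid u (leqnn n))/St_cores. Qed.

Lemma St_ext_biproduct (K : St) (B Y : C) (S : biproduct B Y) (z : E (sval K) S) :
  X Y -> z = push E (inl S) (push E (prl S) z).
Proof.
move=> XY; have [_ _ _ _ e] := biproductE S.
rewrite -[LHS]push_id -e pushD !push_comp.
by rewrite (St_ext0 (push E (prr S) z) XY) raddf0 addr0.
Qed.

Lemma M1_ob (A : C) : cores X n.+1 A -> exists B : M1, sval B = A.
Proof. by move/(vee_cores X_add) => vA; exists (exist _ A vA). Qed.

(** In a coresolution [T -> T0 -> T1] the middle term has [E(K, T0) = 0], so its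
    class generates [F T], with the relations coming from [T0 -> T1]. Full
    faithfulness of [F] follows from this presentation. *)
Lemma F_generator (T : M1) : exists (T0 T1 : St) (x : hom (sval T) (sval T0))
    (y : hom (sval T0) (sval T1)) (d : E (sval T1) (sval T)),
  [/\ X (sval T0), realizes C d x y &
      forall (K : St) (z : F_ob T K), exists c : hom (sval K) (sval T1), z = pull E c d].
Proof.
have [Y [K' [x [y [XY cK [d r]]]]]] := M1_cores T.
have vY : vee (@econf C) X n Y by apply/(vee_cores X_add)/(@cores_le _ _ X_add 0).
have vK : vee (@econf C) X n K' by apply/(vee_cores X_add).
exists (exist _ Y vY), (exist _ K' vK), x, y, d; split=> // K z.
by apply: (tri_ker_push r); apply: St_ext0.
Qed.

Lemma F_faithful (A B : M1) (f g : hom A B) :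
  (forall (K : St) (z : F_ob A K), F_hom f K z = F_hom g K z) -> f = g.
Proof.
have [f' ->] := mcP f; have [g' ->] := mcP g => fg.
have [T0 [T1 [x [y [d [XT r _]]]]]] := F_generator A.
have [|s sE] := tri_desc_ext r (t := f' - g').
  by have := fg T1 d; rewrite !F_mc pushB => ->; rewrite subrr.
have vT : vee (@econf C) X n.+1 (sval T0).
  by apply/(vee_cores X_add)/(@cores_le _ _ X_add 0).
apply/cls_eqP; exists [:: f' - g']; rewrite big_seq1; split=> // h.
by rewrite inE => /eqP->; exists (exist _ (sval T0) vT), x, s.
Qed.

(** Fullness of [F], for natural maps given by their graphs. The value on the
    generator of [F T] determines the morphism; it vanishes on [T0] because the
    generator does and the relation is functional. *)
Lemma F_full (T A : M1) (rho : forall K : St, F_ob T K -> F_ob A K -> Prop) :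
  (forall K z, exists w, rho K z w) ->
  (forall K w, rho K 0 w -> w = 0) ->
  (forall K z w z' w', rho K z w -> rho K z' w' -> rho K (z - z') (w - w')) ->
  (forall K K' (c : hom (sval K') (sval K)) z w, rho K z w ->
     rho K' (pull E c z) (pull E c w)) ->
  exists h : hom T A, forall K z, rho K z (F_hom h K z).
Proof.
move=> tot fnl sub nat.
have [T0 [T1 [x [y [d [XT r gen]]]]]] := F_generator T.
have [w wd] := tot T1 d.
have [|u uE] := tri_ker_pull r (z := (w : E (sval T1) (sval A))).
  by apply: fnl; rewrite -[X in rho _ X _](tri_pull0 r); apply: nat.
exists (mc u) => K z; have [c ->] := gen K z.
rewrite F_mc -pull_push -uE; exact: nat.
Qed.

Lemma F_iso (A B : M1) (f : hom A B) :
  (forall K, injective (F_hom f K)) -> (forall K z, exists w, z = F_hom f K w) -> is_iso f.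
Proof.
move=> inj surj.
have [||||g gE] := @F_full B A (fun K z w => F_hom f K w = z).
- by move=> K z; have [w ->] := surj K z; exists w.
- by move=> K w fw; apply: (inj K); rewrite fw raddf0.
- by move=> K z w z' w' <- <-; rewrite raddfB.
- by move=> K K' c z w <-; rewrite F_hom_pull.
exists g; split; apply: F_faithful => K z; rewrite F_homM F_hom1 //.
by apply: (inj K); rewrite gE.
Qed.

Lemma M1_zero (A : M1) : X (sval A) -> is_zero A.
Proof.
move=> XA; apply: is_zeroP; apply: F_faithful => K z.
by rewrite F_hom0 F_hom1; apply: St_ext0.
Qed.

Lemma M1_additive : is_additive M1.
Proof.
split=> [|A B].
  have [Z z] := has_zero C.
  have [|Z1 e] := @M1_ob Z; first by apply: (@cores_le _ _ X_add 0) => //; apply: X_zero.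
  by exists Z1; apply: M1_zero; rewrite e; apply: X_zero.
have [S _] := has_biproduct (sval A) (sval B).
have vS : vee (@econf C) X n.+1 S.
  by apply/(vee_cores X_add)/(cores_sum X_add X_rigid) => //; apply: M1_cores.
pose S1 : M1 := exist _ (S : C) vS.
have [e1 e2 e3 e4 e5] := biproductE S.
have bp : is_biproduct (@mc A S1 (inl S)) (@mc B S1 (inr S)) (@mc S1 A (prl S)) (@mc S1 B (prr S)).
  by split; rewrite !mcM -?mcD ?e1 ?e2 ?e3 ?e4 ?e5 -?mc0.
by constructor; apply: (Biproduct bp).
Qed.

(** * Short exact sequences of [M1] *)

Local Notation eps := (eps_F n X).
Local Notation "f ## z" := (F_hom f _ z) (at level 35, right associativity).

Lemma epsI (A B D : M1) (a : hom A B) (b : hom B D) :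
  (forall (K : St) (z : F_ob A K), a ## z = 0 -> z = 0) -> b \oc a = 0 ->
  (forall (K : St) (z : F_ob B K), b ## z = 0 -> exists w, z = a ## w) ->
  (forall (K : St) (z : F_ob D K), exists w, z = b ## w) -> eps a b.
Proof.
move=> inj ba0 ker surj K; split=> [z w zw|v|z]; last exact: surj.
  by apply/eqP; rewrite -subr_eq0; apply/eqP/inj; rewrite raddfB zw subrr.
split=> [/ker //|[w ->]].
by rewrite -F_homM ba0 F_hom0.
Qed.

Section OneSequence.
Variables (A B D : M1) (a : hom A B) (b : hom B D) (ab : eps a b).

Lemma eps_inj (K : St) : injective (F_hom a K).
Proof. by have [] := ab K. Qed.

Lemma eps_inj0 (K : St) (z : F_ob A K) : a ## z = 0 -> z = 0.
Proof. by move=> e; apply: (@eps_inj K); rewrite e raddf0. Qed.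

Lemma eps_comp (K : St) (z : F_ob A K) : b ## a ## z = 0.
Proof. by have [_ e _] := ab K; apply/e; exists z. Qed.

Lemma eps_ker (K : St) (z : F_ob B K) : b ## z = 0 -> exists w, z = a ## w.
Proof. by have [_ e _] := ab K; move/e. Qed.

Lemma eps_surj (K : St) (z : F_ob D K) : exists w, z = b ## w.
Proof. by have [_ _ e] := ab K. Qed.

Lemma eps_comp0 : b \oc a = 0.
Proof. by apply: F_faithful => K z; rewrite F_homM F_hom0 eps_comp. Qed.

Lemma eps_kernel : is_kernel b a.
Proof.
split=> [|T t bt]; first exact: eps_comp0.
have [||||u uE] := @F_full T A (fun K z w => a ## w = t ## z).
- move=> K z; have [|w wE] := @eps_ker K (t ## z); first by rewrite -F_homM bt F_hom0.
  by exists w.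
- by move=> K w; rewrite raddf0; apply: eps_inj0.
- by move=> K z w z' w' e e'; rewrite !raddfB e e'.
- by move=> K K' c z w e; rewrite !F_hom_pull e.
exists u; split=> [|v vE]; apply: F_faithful => K z; first by rewrite F_homM uE.
by apply: (@eps_inj K); rewrite uE -F_homM vE.
Qed.

Lemma eps_cokernel : is_cokernel a b.
Proof.
split=> [|T t ta]; first exact: eps_comp0.
have [||||u uE] := @F_full D T (fun K z w => exists be, b ## be = z /\ w = t ## be).
- by move=> K z; have [be ->] := eps_surj z; exists (t ## be), be.
- by move=> K w [be [/eps_ker[al ->] ->]]; rewrite -F_homM ta F_hom0.
- move=> K z w z' w' [be [<- ->]] [be' [<- ->]].
  by exists (be - be'); rewrite !raddfB.
- move=> K K' c z w [be [<- ->]].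
  by exists (pull E c be); rewrite !F_hom_pull.
exists u; split=> [|v vE]; apply: F_faithful => K z.
  rewrite F_homM; have [be [e ->]] := uE K (b ## z).
  have [|al alE] := @eps_ker K (be - z); first by rewrite raddfB e subrr.
  apply/eqP; rewrite -subr_eq0 -raddfB alE -F_homM ta F_hom0 //.
have [be [<- ->]] := uE K z.
by rewrite -vE F_homM.
Qed.

End OneSequence.

Lemma tri_exact_push (A B D K : C) (d : E D A) (x : hom A B) (y : hom B D) (z : E K B) :
  realizes C d x y -> push E y z = 0 -> exists w, z = push E x w.
Proof.
move=> r yz; have [e _] := hext_exact2 H 0 (ETriangle r) K.
exact: (e z).1.
Qed.

Lemma eps_zeroR (A Z : M1) : is_zero Z -> eps (idm A) (0 : hom A Z).
Proof.
move=> z; apply: epsI.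
- by move=> K w; rewrite F_hom1.
- by rewrite compm1.
- by move=> K w _; exists w; rewrite F_hom1.
- by move=> K w; exists 0; rewrite F_hom0 -[w]F_hom1 (to_zero z (idm Z)) F_hom0.
Qed.

Lemma eps_zeroL (A Z : M1) : is_zero Z -> eps (0 : hom Z A) (idm A).
Proof.
move=> z; apply: epsI.
- by move=> K w _; rewrite -[w]F_hom1 (to_zero z (idm Z)) F_hom0.
- by rewrite compm0.
- by move=> K w; rewrite F_hom1 => ->; exists 0; rewrite F_hom0.
- by move=> K w; exists w; rewrite F_hom1.
Qed.

(** The cone [Q] of [(al, a) : A -> A0 + B], for [al] the first step of a
    coresolution of [A], is the cokernel of [a]. The point is that [F(B) -> F(Q)]
    is onto. The cokernel [D] sits in [M1] between [B] and [Q], as [D -j-> Q -r-> D];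
    modulo [X], the endomorphism [1 - j r] of [Q] vanishes on [B], so it factors
    through the cosyzygy [A1] of [A]. As [F(a)] is injective at [A1], it then
    lifts along [A0 + B -> Q]. *)
Lemma eps_realize (A B D : M1) (a : hom A B) (b : hom B D) : eps a b ->
  exists (S Q : M1) (i : hom (sval A) (sval S)) (p : hom (sval S) (sval Q))
      (d : E (sval Q) (sval A)) (s : hom B S) (t : hom D Q),
    [/\ realizes C d i p, forall Y (k : hom (sval A) Y), X Y -> push E k d = 0,
        is_iso s & is_iso t] /\ [/\ @mc A S i = s \oc a & @mc S Q p \oc s = t \oc b].
Proof.
move=> ab; have [a' aE] := mcP a; have [b' bE] := mcP b.
have [A0 [A1 [al [q [ka [XA0 rA _]]]]]] := F_generator A.
have [B0 [B1 [be [yB [la [XB0 rB _]]]]]] := F_generator B.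
have [S _] := has_biproduct (sval A0) (sval B).
have [Q0 [h [e [r1 r2 eh]]]] := tri_pushout (- a') S rA.
rewrite opprK in r2.
have [s1 s2 s3 s4 s5] := biproductE S.
have cA0 m : cores X m (sval A0) by apply: (@cores_le _ _ X_add 0).
have vS : vee (@econf C) X n.+1 S.
  by apply/(vee_cores X_add)/(cores_sum X_add X_rigid) => //; apply: M1_cores.
have vQ : vee (@econf C) X n.+1 Q0.
  apply/(vee_cores X_add)/(cores_extension X_add X_rigid (leqnn _) r1).
  - exact: M1_cores.
  - exact: (coresS X_add (St_cores A1)).
  - by move=> Y k XY; apply: St_ext0.
pose S1 : M1 := exist _ (S : C) vS; pose Q : M1 := exist _ Q0 vQ.
pose b1 : hom (sval B) Q0 := h \oc inr S.
have hi : h \oc pairing S al a' = 0 := tri_comp0 r2.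
have b1a (K : St) (z : F_ob A K) : push E b1 (a ## z) = 0.
  have z0 : push E al z = 0 by apply: St_ext0.
  rewrite aE F_mc -push_comp; move: hi; rewrite compDr !compA => /eqP.
  by rewrite addrC addr_eq0 => /eqP->; rewrite pushN push_comp z0 raddf0 oppr0.
have [||||j jE] := @F_full D Q (fun K z w => exists v, b ## v = z /\ w = push E b1 v).
- by move=> K z; have [v ->] := eps_surj ab z; exists (push E b1 v), v.
- by move=> K w [v [/(eps_ker ab)[u ->] ->]]; apply: b1a.
- move=> K z w z' w' [v [<- ->]] [v' [<- ->]].
  by exists (v - v'); rewrite !raddfB.
- move=> K K' c z w [v [<- ->]].
  by exists (pull E c v); rewrite F_hom_pull; split=> //; apply: pull_push.
have jb (K : St) (v : F_ob B K) : j ## b ## v = push E b1 v.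
  have [v' [e1 ->]] := jE K (b ## v).
  have [|u uE] := eps_ker ab (z := v' - v); first by rewrite raddfB e1 subrr.
  by apply/eqP; rewrite -subr_eq0 -raddfB uE b1a.
(* [(v, b) : A0 + B -> D] kills [A] and descends to a retraction of [j] *)
have [|v vE] := tri_desc_ext rA (t := - (b' \oc a')).
  rewrite pushN; have := eps_comp ab (ka : F_ob A A1).
  by rewrite aE bE !F_mc push_comp => ->; rewrite oppr0.
have [|r rE] := tri_desc r2 (t := copair S v b').
  by rewrite copair_pair vE addNr.
have rb1 : r \oc b1 = b' by rewrite /b1 compA rE copair_inr.
(* [f] represents [1 - j r], which vanishes on [F(B)] *)
have [f fE] := mcP (idm Q - j \oc @mc Q D r).
have fQ (K : St) (z : F_ob Q K) : push E f z = z - j ## push E r z.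
  by rewrite -(F_mc (A := Q) (B := Q)) -fE F_homD F_hom1 F_homN F_homM F_mc.
have [|v2 v2E] := tri_desc_ext rB (t := f \oc b1).
  rewrite push_comp (fQ B1 (push E b1 la)) -push_comp rb1.
  by have := jb B1 la; rewrite {1}bE F_mc => ->; rewrite subrr.
have [|ub ubE] := tri_desc_ext r1 (t := be); first exact: St_ext0.
have [|e' e'E] := tri_desc r1 (t := f - v2 \oc ub).
  by rewrite compDl compNm -compA ubE v2E -/b1 subrr.
have [|l lE] := tri_lift_ext r2 (t := e').
  apply: (eps_inj0 ab (K := A1)); rewrite aE F_mc.
  have := congr1 (pull E e') (tri_push0 r2); rewrite raddf0 pull_push.
  move/(congr1 (push E (prr S))); rewrite raddf0 -push_comp prr_pair.
  by [].
have inS (K : St) (z : E (sval K) S) : push E (inr S) (push E (prr S) z) = z.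
  exact/esym/(St_ext_biproduct (S := biproduct_sym S) z XA0).
have pS (K : St) (z : E (sval K) S) : push E h z = push E b1 (push E (prr S) z).
  by rewrite -[z in LHS]inS -push_comp.
have surj (K : St) (z : F_ob Q K) : exists u, z = push E b1 u.
  have e0 : push E f z = push E b1 (push E (prr S) (push E l (push E e z))).
    rewrite -pS -push_comp lE -push_comp e'E pushB push_comp.
    by rewrite (St_ext0 (push E ub z) XB0) raddf0 subr0.
  move: e0; rewrite fQ; set u := push E (prr S) _.
  have [w wE] := eps_surj ab (push E r z : F_ob D K).
  rewrite wE jb => /eqP; rewrite subr_eq -raddfD => /eqP->.
  by eexists.
exists S1, Q, (pairing S al a'), h, (pull E e ka), (@mc B S1 (inr S)), j.
split; split=> //.
- by move=> Y k XY; rewrite -pull_push (St_ext0 (push E k ka) XY) raddf0.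
- exists (@mc S1 B (prr S)); rewrite !mcM s2; split=> //.
  apply: F_faithful => K z; rewrite F_mc F_hom1.
  by rewrite push_comp inS.
- apply: F_iso => K.
    move=> z z' /eqP; rewrite -subr_eq0 -raddfB => /eqP.
    have [w wE] := eps_surj ab (z - z').
    rewrite wE jb /b1 push_comp => /(tri_exact_push r2)[u uE].
    apply/eqP; rewrite -subr_eq0 wE.
    have -> : w = a ## u.
      by rewrite aE F_mc -[w]push_id -s2 push_comp uE -push_comp prr_pair.
    by rewrite (eps_comp ab).
  by move=> z; have [u ->] := surj K z; exists (b ## u); rewrite jb.
- rewrite aE mcM; apply: F_faithful => K z; rewrite !F_mc pushD.
  by rewrite [push E (inl S \oc _) z]push_comp (St_ext0 (push E al z) XA0) raddf0 add0r.
- by apply: F_faithful => K z; rewrite mcM F_mc F_homM jb.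
Qed.

Lemma F_iso_can (A B : M1) (f : hom A B) : is_iso f -> exists g : hom B A,
  (forall K (z : F_ob A K), g ## f ## z = z) /\ (forall K (z : F_ob B K), f ## g ## z = z).
Proof. by move=> [g [gf fg]]; exists g; split=> K z; rewrite -F_homM ?gf ?fg F_hom1. Qed.

Lemma eps_isoclosed (A B D A' B' D' : M1) (x : hom A B) (y : hom B D)
    (x' : hom A' B') (y' : hom B' D') (a : hom A A') (b : hom B B') (d : hom D D') :
  eps x y -> is_iso a -> is_iso b -> is_iso d ->
  b \oc x = x' \oc a -> d \oc y = y' \oc b -> eps x' y'.
Proof.
move=> xy /F_iso_can[a' [a1 a2]] /F_iso_can[b' [b1 b2]] /F_iso_can[d' [d1 d2]] sx sy.
have xE K (z : F_ob A K) : x' ## a ## z = b ## x ## z by rewrite -!F_homM sx.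
have yE K (z : F_ob B K) : y' ## b ## z = d ## y ## z by rewrite -!F_homM sy.
apply: epsI.
- move=> K z; rewrite -[z]a2 xE => e.
  by rewrite (eps_inj0 xy (z := a' ## z)) ?raddf0 // -[LHS]b1 e raddf0.
- apply: F_faithful => K z.
  by rewrite F_homM -[z]a2 xE yE (eps_comp xy) raddf0 F_hom0.
- move=> K z; rewrite -[z]b2 yE => e; have [|w ->] := eps_ker xy (z := b' ## z).
    by rewrite -[LHS]d1 e raddf0.
  by exists (a ## w); rewrite xE.
- move=> K z; have [w wE] := eps_surj xy (d' ## z).
  by exists (b ## w); rewrite yE -wE d2.
Qed.

(** Pushouts and pullbacks of conflations are pushed out and pulled back in
    the extriangulated category, along the realization above. *)
Lemma eps_pushout (A B D A' : M1) (a : hom A B) (b : hom B D) (f : hom A A') : eps a b ->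
  exists (G : M1) (i : hom A' G) (g : hom B G) (p : hom G D),
    [/\ eps i p, i \oc f = g \oc a & p \oc g = b].
Proof.
move=> ab; have [S [Q [x [y [d [s [t [[r dX si ti] [sx sy]]]]]]]]] := eps_realize ab.
have [f' fE] := mcP f; have [t' [t1 t2]] := ti.
have [G0 [i' [p' [r' _]]]] := realizes_class (push E f' d).
have [|g' [gx py]] := realizes_morphP r r' (a := f') (c := idm _).
  by rewrite /ext_morph pull_id.
have vG : vee (@econf C) X n.+1 G0.
  apply/(vee_cores X_add)/(cores_extension X_add X_rigid (leqnn _) r'); try exact: M1_cores.
  by move=> Y k XY; rewrite -push_comp; apply: dX.
pose G : M1 := exist _ G0 vG.
have pg : (t' \oc @mc G Q p') \oc (@mc S G g' \oc s) = b.
  by rewrite -compA (compA _ _ s) mcM -py comp1m sy compA t1 comp1m.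
exists G, (@mc A' G i'), (@mc S G g' \oc s), (t' \oc @mc G Q p'); split=> //.
- apply: epsI.
  + move=> K z; rewrite F_mc => /(tri_ker_push r')[c ->].
    have w0 : push E x (pull E c d) = 0 by rewrite -pull_push (tri_push0 r) raddf0.
    rewrite pull_push; suff -> : pull E c d = 0 by rewrite raddf0.
    apply: (eps_inj0 ab (K := K)); have [s' [s1 _]] := F_iso_can si.
    by rewrite -[LHS]s1 -(F_homM s) -sx F_mc w0 raddf0.
  + by rewrite -compA mcM (tri_comp0 r') mc0 compm0.
  + move=> K z; rewrite F_homM => e; have [t'' [t3 _]] := F_iso_can (ex_intro _ t (conj t2 t1)).
    have : @mc G Q p' ## z = 0 by rewrite -[LHS]t3 e raddf0.
    by rewrite F_mc => /(tri_exact_push r')[w wE]; exists w; rewrite F_mc.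
  + move=> K z; have [w ->] := eps_surj ab z.
    by exists ((@mc S G g' \oc s) ## w); rewrite -F_homM pg.
- by rewrite fE mcM -compA -sx mcM gx.
Qed.

Lemma eps_pullback (A B D D' : M1) (a : hom A B) (b : hom B D) (f : hom D' D) : eps a b ->
  exists (G : M1) (k : hom A G) (l : hom G D') (g : hom G B),
    [/\ eps k l, g \oc k = a & b \oc g = f \oc l].
Proof.
move=> ab; have [S [Q [x [y [d [s [t [[r dX si ti] [sx sy]]]]]]]]] := eps_realize ab.
have [f' fE] := mcP (t \oc f); have [s' [s1 s2]] := si; have [t' [t1 t2]] := ti.
have [G0 [k' [l' [r' _]]]] := realizes_class (pull E f' d).
have [|g' [gk yg]] := realizes_morphP r' r (a := idm _) (c := f').
  by rewrite /ext_morph push_id.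
have vG : vee (@econf C) X n.+1 G0.
  apply/(vee_cores X_add)/(cores_extension X_add X_rigid (leqnn _) r'); try exact: M1_cores.
  by move=> Y k XY; rewrite -pull_push (dX _ _ XY) raddf0.
pose G : M1 := exist _ G0 vG.
have gka : (s' \oc @mc G S g') \oc @mc A G k' = a.
  by rewrite -compA mcM gk compm1 sx compA s1 comp1m.
exists G, (@mc A G k'), (@mc G D' l'), (s' \oc @mc G S g'); split=> //; last first.
  have e : t \oc (b \oc (s' \oc @mc G S g')) = t \oc (f \oc @mc G D' l').
    by rewrite (compA t f) fE mcM yg compA -sy -(compA _ s) (compA s) s2 comp1m mcM.
  by rewrite -[LHS]comp1m -[RHS]comp1m -t1 -!(compA t') e.
apply: epsI.
- move=> K z e; apply: (eps_inj0 ab).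
  by rewrite -gka F_homM e raddf0.
- by rewrite mcM (tri_comp0 r') mc0.
- by move=> K z; rewrite F_mc => /(tri_exact_push r')[w wE]; exists w; rewrite F_mc.
- move=> K z.
  (* [z] lifts iff its image in [E^2(K, A)] vanishes, which can be seen over [S] *)
  pose T1 := ETriangle r'; pose T := ETriangle r.
  have mor : @etriangle_morph C T1 T (idm (sval A)) g' f'.
    by split=> //; rewrite /ext_morph push_id.
  have cm := @con2_morph C H 0 T1 T _ _ _ (sval K) mor z; rewrite push_id in cm.
  have [_ ex1] := hext_exact2 H 0 T1 (sval K); have [_ ex2] := hext_exact2 H 0 T (sval K).
  have [w wE] := eps_surj ab (f ## z).
  have /ex1[u uE] : con2 H 0 T1 (sval K) z = 0.
    rewrite -cm; apply/ex2; exists (s ## w).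
    rewrite -[LHS](F_mc (A := D') (B := Q)) -fE F_homM wE -F_homM -sy.
    by rewrite F_homM F_mc.
  by exists u; rewrite F_mc.
Qed.

Lemma eps_is_pushout (A B D A' G : M1) (a : hom A B) (b : hom B D) (f : hom A A')
    (i : hom A' G) (g : hom B G) (p : hom G D) :
  eps a b -> eps i p -> i \oc f = g \oc a -> p \oc g = b -> is_pushout a f i g.
Proof.
move=> ab ip sq pg; split=> [//|T u v uv].
have sqE K (z : F_ob A K) : i ## f ## z = g ## a ## z by rewrite -!F_homM sq.
have pgE K (z : F_ob B K) : p ## g ## z = b ## z by rewrite -!F_homM pg.
have zero K (z : F_ob B K) (z' : F_ob A' K) : g ## z + i ## z' = 0 -> u ## z + v ## z' = 0.
  move=> e; have [|w wE] := eps_ker ab (z := z).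
    move: (congr1 (F_hom p K) e).
    by rewrite raddfD pgE (eps_comp ip) addr0 raddf0.
  have -> : z' = - (f ## w).
    apply: (eps_inj ip (K := K)); rewrite raddfN sqE -wE.
    by apply/eqP; rewrite -addr_eq0 addrC e.
  by rewrite raddfN wE -!F_homM uv subrr.
have [||||w wE] := @F_full G T (fun K z w => exists (be : F_ob B K) (al : F_ob A' K),
   z = g ## be + i ## al /\ w = u ## be + v ## al).
- move=> K z; have [be beE] := eps_surj ab (p ## z).
  have [|al alE] := eps_ker ip (z := z - g ## be); first by rewrite raddfB pgE beE subrr.
  by exists (u ## be + v ## al), be, al; rewrite -alE addrCA subrr addr0.
- by move=> K w [be [al [/esym/zero e ->]]].
- move=> K z w z' w' [be [al [-> ->]]] [be' [al' [-> ->]]].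
  by exists (be - be'), (al - al'); rewrite !raddfB /= !opprD !(addrACA _ _ (- _)).
- move=> K K' c z w [be [al [-> ->]]].
  by exists (pull E c be), (pull E c al); rewrite !F_hom_pull !raddfD.
have graph K (be : F_ob B K) (al : F_ob A' K) : w ## (g ## be + i ## al) = u ## be + v ## al.
  have [be' [al' [e ->]]] := wE K (g ## be + i ## al).
  have := zero K (be' - be) (al' - al); rewrite !raddfB /= addrACA -opprD -e subrr addrACA -opprD.
  by move=> /(_ erefl)/eqP; rewrite subr_eq0 => /eqP.
exists w; split=> [|w' [w1 w2]].
  split; apply: F_faithful => K z; rewrite F_homM.
    by have := graph K z 0; rewrite !raddf0 !addr0.
  by have := graph K 0 z; rewrite !raddf0 !add0r.
apply: F_faithful => K z; have [be [al [-> _]]] := wE K z.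
by rewrite graph raddfD -!F_homM w1 w2.
Qed.

Lemma eps_is_pullback (A B D D' G : M1) (a : hom A B) (b : hom B D) (f : hom D' D)
    (k : hom A G) (l : hom G D') (g : hom G B) :
  eps a b -> eps k l -> g \oc k = a -> b \oc g = f \oc l -> is_pullback b f l g.
Proof.
move=> ab kl gk sq; split=> [//|T u v uv].
have gkE K (z : F_ob A K) : g ## k ## z = a ## z by rewrite -F_homM gk.
have sqE K (z : F_ob G K) : b ## g ## z = f ## l ## z by rewrite -!F_homM sq.
have zero K (w : F_ob G K) : g ## w = 0 -> l ## w = 0 -> w = 0.
  move=> gw /(eps_ker kl)[al e].
  by rewrite e (eps_inj0 ab (z := al)) ?raddf0 // -gkE -e.
have [||||w wE] := @F_full T G (fun K z w => g ## w = u ## z /\ l ## w = v ## z).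
- move=> K z; have [w0 w0E] := eps_surj kl (v ## z).
  have [|al alE] := eps_ker ab (z := u ## z - g ## w0).
    by rewrite raddfB sqE -w0E -!F_homM uv subrr.
  exists (w0 + k ## al); rewrite !raddfD gkE -alE addrCA subrr addr0.
  by rewrite (eps_comp kl) addr0.
- by move=> K w []; rewrite !raddf0; apply: zero.
- by move=> K z w z' w' [e1 e2] [e3 e4]; rewrite !raddfB e1 e2 e3 e4.
- by move=> K K' c z w [e1 e2]; rewrite !F_hom_pull e1 e2.
exists w; split=> [|w' [w1 w2]].
  by split; apply: F_faithful => K z; rewrite F_homM; have [e1 e2] := wE K z.
apply: F_faithful => K z; apply/eqP; rewrite -subr_eq0; apply/eqP; have [e1 e2] := wE K z.
by apply: zero; rewrite raddfB ?e1 ?e2 -F_homM ?w1 ?w2 subrr.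
Qed.

Lemma eps_exact : is_exact eps.
Proof.
have [[Z z] aM] := M1_additive; split.
- exact: M1_additive.
- by move=> A B D x y xy; split; [apply: eps_kernel | apply: eps_cokernel].
- exact: eps_isoclosed.
- by move=> A; exists Z, 0; apply: eps_zeroR.
- by move=> A; exists Z, 0; apply: eps_zeroL.
- move=> A B G x x' [D [y xy]] [D' [y' xy']].
  have [P [i [g [p [ip sq pg]]]]] := eps_pushout y xy'.
  have sqE K (w : F_ob B K) : i ## y ## w = g ## x' ## w by rewrite -!F_homM sq.
  have pgE K (w : F_ob G K) : p ## g ## w = y' ## w by rewrite -F_homM pg.
  exists P, g; apply: epsI.
  + by move=> K w; rewrite F_homM => /(eps_inj0 xy')/(eps_inj0 xy).
  + by rewrite compA -sq -compA (eps_comp0 xy) compm0.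
  + move=> K w gw; have [|u uE] := eps_ker xy' (z := w); first by rewrite -pgE gw raddf0.
    have [|v vE] := eps_ker xy (z := u).
      by apply: (eps_inj0 ip); rewrite sqE -uE.
    by exists v; rewrite F_homM -vE.
  + move=> K w; have [u uE] := eps_surj xy' (p ## w).
    have [|v vE] := eps_ker ip (z := w - g ## u); first by rewrite raddfB pgE uE subrr.
    have [v' v'E] := eps_surj xy v.
    by exists (u + x' ## v'); rewrite raddfD -sqE -v'E -vE addrCA subrr addr0.
- move=> A B G y y' [K0 [x xy]] [K1 [x' xy']].
  have [L [k [l [g [kl gk sq]]]]] := eps_pullback x' xy.
  have gkE K (w : F_ob K0 K) : g ## k ## w = x ## w by rewrite -F_homM gk.
  have sqE K (w : F_ob L K) : y ## g ## w = x' ## l ## w by rewrite -!F_homM sq.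
  exists L, g; apply: epsI.
  + move=> K w gw; have [|u uE] := eps_ker kl (z := w).
      by apply: (eps_inj0 xy'); rewrite -sqE gw raddf0.
    by rewrite uE (eps_inj0 xy (z := u)) ?raddf0 // -gkE -uE.
  + by rewrite -compA sq compA (eps_comp0 xy') comp0m.
  + move=> K w; rewrite F_homM => /(eps_ker xy')[u uE]; have [v vE] := eps_surj kl u.
    have [|t tE] := eps_ker xy (z := w - g ## v); first by rewrite raddfB sqE -vE uE subrr.
    by exists (v + k ## t); rewrite raddfD gkE -tE addrCA subrr addr0.
  + move=> K w; have [u ->] := eps_surj xy' w; have [v ->] := eps_surj xy u.
    by exists v; rewrite F_homM.
- move=> A B A' x f [D [y xy]]; have [G [i [g [p [ip sq pg]]]]] := eps_pushout f xy.
  exists G, i, g; split; first exact: (eps_is_pushout xy ip).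
  by exists D, p.
- move=> B D D' y f [A [x xy]]; have [G [k [l [g [kl gk sq]]]]] := eps_pullback f xy.
  exists G, l, g; split; first exact: (eps_is_pullback xy kl).
  by exists A, k.
Qed.

(** * Split epimorphisms of [M1] and split triangles *)

Section AddedSummands.
Variables (M N : M1) (b : hom (sval M) (sval N)) (Y P : C) (g : hom Y (sval N))
  (p : hom P (sval N)) (MY : biproduct (sval M) Y) (S : biproduct MY P).
Hypotheses (XY : X Y) (XP : X P).
Notation prM := (prl MY \oc prl S).
Notation inM := (inl S \oc inl MY).
Notation bgp := (copair S (copair MY b g) p).

Lemma St_ext_added (K : St) (z : E (sval K) S) : z = push E inM (push E prM z).
Proof.
by rewrite !push_comp -(St_ext_biproduct (push E (prl S) z) XY) -(St_ext_biproduct z XP).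
Qed.

Lemma bgp_inM : bgp \oc inM = b.
Proof. by rewrite compA !copair_inl. Qed.

Lemma prM_inM : prM \oc inM = idm (sval M).
Proof.
have [e1 _ _ _ _] := biproductE S; have [e2 _ _ _ _] := biproductE MY.
by rewrite -compA (comp_assoc e1) comp1m e2.
Qed.

Lemma push_bgp (K : St) (z : E (sval K) S) : push E bgp z = push E b (push E prM z).
Proof. by rewrite [in LHS](St_ext_added z) -push_comp bgp_inM. Qed.

(** Modulo [X] only the component [b] of [(b, g, p)] remains. *)
Lemma bgp_split_epi (sg : hom (sval N) S) : bgp \oc sg = idm (sval N) ->
  split_epi (@mc M N b).
Proof.
move=> e; exists (@mc N M (prM \oc sg)); apply: F_faithful => K z.
by rewrite mcM F_mc F_hom1 push_comp [push E (_ \oc sg) _]push_comp -push_bgp -push_comp e push_id.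
Qed.

(** The summands [Y] and [P] lie in [X], hence are invisible to [F], and a split
    triangle stays short exact under [E(K, -)]. *)
Lemma eps_split_triangle (K' : M1) (a' : hom (sval K') S) (d : E (sval N) (sval K')) :
  realizes C d a' bgp -> d = 0 -> eps (@mc K' M (prM \oc a')) (@mc M N b).
Proof.
move=> r d0; apply: epsI.
- move=> K z; rewrite F_mc push_comp => e.
  have /(tri_ker_push r)[c ->] : push E a' z = 0.
    by rewrite (St_ext_added (push E a' z)) e raddf0.
  by rewrite d0 raddf0.
- apply: F_faithful => K z; rewrite mcM F_mc F_hom0 push_comp.
  by rewrite [push E (_ \oc a') _]push_comp -push_bgp -push_comp (tri_comp0 r) push0.
- move=> K z; rewrite F_mc => bz.
  have [|w wE] := tri_exact_push r (z := push E inM z).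
    by rewrite -push_comp bgp_inM.
  by exists w; rewrite F_mc push_comp -wE -push_comp prM_inM push_id.
- move=> K z; have [|sg sgE] := tri_lift_ext r (t := idm (sval N)); first by rewrite d0 raddf0.
  exists (push E prM (push E sg z)).
  by rewrite F_mc -push_bgp -push_comp sgE push_id.
Qed.

End AddedSummands.

(** A section of [[b]] is a section of [b] up to a map through [Y] in [X]; so
    [(b, g)] is split epi for some [g : Y -> N], and adding a projective cover of
    [N] turns it into a deflation, whose kernel is then a summand. *)
Lemma split_epi_triangle (enough : enough_eproj C) (X_proj : forall P : C, eproj P -> X P)
    (M N : M1) (b : hom (sval M) (sval N)) : split_epi (@mc M N b) ->
  exists (K' : M1) (Y P : C) (MY : biproduct (sval M) Y) (S : biproduct MY P)
      (g : hom Y (sval N)) (p : hom P (sval N)) (a' : hom (sval K') S)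
      (d : E (sval N) (sval K')),
    [/\ X Y, eproj P, realizes C d a' (copair S (copair MY b g) p) & d = 0].
Proof.
move=> [s sE]; have [s' s'E] := mcP s.
have [N0 [N1 [x [yN [dN [XY rN _]]]]]] := F_generator N.
have [|v vE] := tri_desc_ext rN (t := b \oc s' - idm _).
  rewrite pushB push_id; apply/eqP; rewrite subr_eq0; apply/eqP.
  by rewrite -[RHS](F_hom1 (K := N1)) -sE s'E mcM F_mc.
have [P [p [Pp [Om [om [ka rP]]]]]] := enough (sval N).
have [MY _] := has_biproduct (sval M) (sval N0); have [S' _] := has_biproduct P MY.
have [K0 [a' [d r]]] := tri_copair_deflation (copair MY b (- v)) S' rP.
have r' : realizes C d a' (copair (biproduct_sym S') (copair MY b (- v)) p).
  by rewrite /copair addrC.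
have d0 : d = 0.
  rewrite -[d]pull_id.
  have <- : copair S' p (copair MY b (- v)) \oc (inr S' \oc pairing MY s' x) = idm (sval N).
    by rewrite compA copair_inr copair_pair compNm vE opprB addrCA subrr addr0.
  by rewrite pull_comp (tri_pull0 r) raddf0.
have [T _] := has_biproduct K0 (sval N).
have cX m A : X A -> cores X m A by apply: (@cores_le _ _ X_add 0).
have [K' K'E] : exists K' : M1, sval K' = K0.
  apply: M1_ob; apply: (cores_summand X_add X_rigid (S := T)) => //.
  apply: (cores_iso X_add _ (tri_split r T d0)).
  apply: (cores_sum X_add X_rigid) => //; first exact/cX/X_proj.
  by apply: (cores_sum X_add X_rigid) => //; [apply: M1_cores | apply: cX].
subst K0.
by exists K', (sval N0), P, MY, (biproduct_sym S'), (- v), p, a', d.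
Qed.

End FunctorF.

(** * Presentations of the functors [F M] *)

Section YonedaMap.
Variables (A : precat) (G : module A) (Y : A) (z : G Y).

Section At.
Variable B : A.
Definition yoneda_elt (c : hom B Y) : G B := mact G c z.
Lemma yoneda_elt_additive : zmod_morphism yoneda_elt.
Proof.
move=> c c'; rewrite /yoneda_elt.
by apply/eqP; rewrite eq_sym subr_eq -mactD addrNK.
Qed.
HB.instance Definition _ :=
  GRing.isZmodMorphism.Build (hom B Y) (G B) yoneda_elt yoneda_elt_additive.
End At.

Lemma yoneda_elt_nat (B D : A) (f : hom B D) (c : yoneda Y D) :
  yoneda_elt (mact (yoneda Y) f c) = mact G f (yoneda_elt c).
Proof. exact: mact_comp. Qed.

Definition yoneda_map : mhom (yoneda Y) G :=
  @MHom _ (yoneda Y) G (fun B => GRing.Additive.clone _ _ (@yoneda_elt B) _) yoneda_elt_nat.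

End YonedaMap.

Section Main.
Variables (C : extriangulated) (H : higher_ext C) (n : nat) (X : C -> Prop).
Hypothesis X_add : forall A : C, X A <-> add X A.
Hypothesis X_rigid : rigid H n X.
Notation E := (extE C).
Notation St := (Xvee_stable n X).

Lemma ebar_cls (M : M1 n X) (K K' : St) (c : hom (sval K) (sval K')) (z : F_ob M K') :
  mact (F_ob M) (cls (proj_ideal n X) c : hom K K') z = pull E c z.
Proof. exact: (@pull_repr C n X K K'). Qed.

(** The presentation of [F_generator], read through the Yoneda lemma. *)
Lemma F_inR (M : M1 n X) : inR (F_ob M).
Proof.
have [T0 [T1 [x [y [d [XT r gen]]]]]] := F_generator X_add X_rigid M.
pose yc : hom T0 T1 := cls (proj_ideal n X) (y : @hom (Xvee X n) T0 T1).
exists T0, T1, (yoneda_map (yc : yoneda T1 T0)), (yoneda_map (d : F_ob M T1)); split=> // B.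
split=> [c|z]; last first.
  have [c ->] := gen B z; exists (cls (proj_ideal n X) (c : @hom (Xvee X n) B T1)).
  exact/esym/ebar_cls.
split=> [|[t ->]]; last first.
  rewrite [LHS](mact_comp yc t (d : F_ob M T1)) [X in mact _ _ X]ebar_cls.
  by rewrite (tri_pull0 r) raddf0.
rewrite -[c]cls_repr => cd; have [|t tE] := tri_lift_ext r (t := generic_quotient.repr c).
  by rewrite -[LHS](ebar_cls (M := M)).
exists (cls (proj_ideal n X) (t : @hom (Xvee X n) B T0)).
rewrite [RHS]/(yc \oc cls _ _) [RHS]qcomp_cls.
by congr (cls _ _); rewrite -tE.
Qed.

Lemma F_miso (A B : M1 n X) (h : hom A B) : is_iso h -> miso (F_hom h).
Proof.
move=> /(F_iso_can X_rigid)[g [gh hg]].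
by exists (F_hom g) => K; split=> z; [apply: gh | apply: hg].
Qed.

End Main.

Theorem theorem4p1 (C : extriangulated) (H : higher_ext C) (n : nat)
    (X : C -> Prop)
    (enough : enough_eproj C)
    (X_add : forall A : C, X A <-> add X A)
    (X_rigid : rigid H n X)
    (X_proj : forall P : C, eproj P -> X P) :
  (is_exact (eps_F n X) /\ weakly_idempotent_complete (M1 n X)) /\
  (pseudo_cluster_tilting (degreewise (eps_F n X)) (@split_conf _ (eps_F n X)) /\
   forall s : conf_cat (eps_F n X),
     wedge (degreewise (eps_F n X)) (@split_conf _ (eps_F n X)) 1 s /\
     vee (degreewise (eps_F n X)) (@split_conf _ (eps_F n X)) 1 s) /\
  is_abelian (quot_cat (factor_ideal (@split_conf _ (eps_F n X)))) /\
  forall (K M N : M1 n X) (a : hom (sval K) (sval M)) (b : hom (sval M) (sval N))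
    (eta : eps_F n X (cls (Xideal n X) a : hom K M) (cls (Xideal n X) b : hom M N)),
    split_conf (Conflation eta) <->
    exists (K' : M1 n X) (Y P : C) (MY : biproduct (sval M) Y) (S : biproduct MY P)
      (g : hom Y (sval N)) (p : hom P (sval N)) (a' : hom (sval K') S)
      (delta : extE C (sval N) (sval K')) (phi : mhom (F_ob K') (F_ob K)),
      (* [a1] is the class of [a'] in [M1] followed by the projection of
         [M + Y + P] onto [M] *)
      let a1 : hom K' M := cls (Xideal n X) (prl MY \oc prl S \oc a') in
      let a0 : hom K M := cls (Xideal n X) a in
      let b0 : hom M N := cls (Xideal n X) b in
      [/\ X Y, eproj P,
          realizes C delta a' (copair S (copair MY b g) p) & delta = 0] /\
      [/\ R_conf (F_hom a1) (F_hom b0),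
          R_conf (F_hom a0) (F_hom b0),
          miso phi,
          msquare (F_hom a1) (F_hom a0) phi (mid (F_ob M))
        & msquare (F_hom b0) (F_hom b0) (mid (F_ob M)) (mid (F_ob N))].
Proof.
have ex := eps_exact X_add X_rigid.
have inR M := F_inR X_add X_rigid M.
split; [split=> // | split; [split | split]].
- move=> A B q; have [f ->] := mcP q => sf.
  have [K' [Y [P [MY [S [g [p [a' [d [XY Pp r d0]]]]]]]]]] :=
    split_epi_triangle X_add X_rigid enough X_proj sf.
  have c := eps_split_triangle X_add X_rigid XY (X_proj _ Pp) r d0.
  by exists K', (mc (prl MY \oc prl S \oc a')); apply: (eps_kernel X_add X_rigid c).
- exact: split_pseudo_cluster_tilting.
- by move=> s; apply: pseudo_cluster_tilting_resolutions; apply: split_pseudo_cluster_tilting.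
- exact: quot_split_abelian.
move=> K M N a b eta; split.
  move=> /(splitP ex)[q /= qE].
  have sf : split_epi (@mc C n X M N b) by exists q.
  have [K' [Y [P [MY [S [g [p [a' [d [XY Pp r d0]]]]]]]]]] :=
    split_epi_triangle X_add X_rigid enough X_proj sf.
  have c := eps_split_triangle X_add X_rigid XY (X_proj _ Pp) r d0.
  have [h [ih hE]] := kernel_iso (eps_kernel X_add X_rigid eta) (eps_kernel X_add X_rigid c).
  exists K', Y, P, MY, S, g, p, a', d, (F_hom h); split; split=> //.
  - exact: (F_miso X_rigid).
  - by move=> B z; rewrite -(F_homM X_rigid) hE.
move=> [K' [Y [P [MY [S [g [p [a' [d [_ [[XY Pp r d0] _]]]]]]]]]]].
have [|sg sgE] := tri_lift_ext r (t := idm (sval N)); first by rewrite d0 raddf0.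
have [q qE] := bgp_split_epi X_add X_rigid XY (X_proj _ Pp) sgE.
by apply/(splitP ex); exists q.
Qed.
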